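(* There is a universal constant $C>0$ such that for every $\varepsilon\in(0,\tfrac12]$ and every $n\in\mathbb N$ the following holds. Every $n$-point tree metric $(V,d_T)$ admits a $(1+\varepsilon)$-embedding into $\ell_1^k$ for some integer $k\ge 0$ with $$k\le C\left(\tfrac1\varepsilon\right)^4\log\tfrac1\varepsilon\cdot\log n .$$
   Context: Let $T=(V,E)$ be a finite, connected, undirected tree with a length function $\mathrm{len}:E\to[0,\infty)$. It induces the shortest-path pseudometric $d_T(u,v)=$ length of the (unique) $u$-$v$ path in $T$. Such a space $(V,d_T)$ is called a finite tree metric; it is an $n$-point tree metric if $|V|=n$. Points at distance $0$ are identified. $\ell_1^k$ denotes $\mathbb R^k$ with the norm $\|\cdot\|_1$. For $f:(X,d_X)\to(Y,d_Y)$, $\|f\|_{\mathrm{Lip}}=\sup_{x\ne y}\frac{d_Y(f(x),f(y))}{d_X(x,y)}$, and the distortion of $f$ is $\|f\|_{\mathrm{Lip}}\cdot\|f^{-1}\|_{\mathrm{Lip}}$ (infinite if $f$ is not injective). A $D$-embedding is a map with distortion at most $D$. *)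

(* Defs.v *)
From HB Require Import structures.
From mathcomp Require Import all_boot all_order all_algebra.
From mathcomp Require Import all_classical all_reals all_analysis.

Set Implicit Arguments.
Unset Strict Implicit.
Unset Printing Implicit Defensive.

Import Order.TTheory GRing.Theory Num.Theory.

Local Open Scope classical_set_scope.
Local Open Scope ring_scope.

(* [ucycle] counts [:: x] (a loop) and [:: x; y] (an edge walked back and
   forth) as cycles, hence the bound on the size. *)
Definition is_tree (V : finType) (e : rel V) : Prop :=
  [/\ symmetric e, irreflexive e, (0 < #|V|)%N,
      forall x y : V, connect e x y
    & forall c : seq V, ucycle e c -> (size c <= 2)%N].

(* The edge between x and y is the two-element set {x, y}; the values of
   [len] on other sets are irrelevant. *)
Record metric_tree (R : realType) := MetricTree {
  vertex : finType;
  edge : rel vertex;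
  len : {set vertex} -> R;
  edge_tree : is_tree edge;
  len_ge0 : forall x y : vertex, edge x y -> 0 <= len [set x; y]%SET }.

Section TreeMetric.
Context {R : realType} (T : metric_tree R).
Implicit Types (u v w : vertex T) (p q : seq (vertex T)).

Definition walk_length u p : R :=
  \sum_(l <- pairmap (fun x y => len [set x; y]%SET) u p) l.

Definition tree_dist u v : R :=
  inf [set walk_length u p | p in [set p | path (@edge R T) u p /\ last u p = v]].

Lemma edgeC : symmetric (@edge R T).
Proof. by case: (edge_tree T). Qed.

Lemma walk_length_ge0 u p : path (@edge R T) u p -> 0 <= walk_length u p.
Proof.
rewrite /walk_length; elim: p u => [|x p IHp] u /=; first by rewrite big_nil.
by case/andP=> eux /IHp; rewrite big_cons; apply/addr_ge0/len_ge0.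
Qed.

Lemma walk_length_cat u p q :
  walk_length u (p ++ q) = walk_length u p + walk_length (last u p) q.
Proof. by rewrite /walk_length pairmap_cat big_cat. Qed.

Lemma walk_length_rev u p :
  walk_length (last u p) (rev (belast u p)) = walk_length u p.
Proof.
elim: p u => [//|x p IHp] u /=.
rewrite rev_cons -cats1 walk_length_cat IHp.
have -> : last (last x p) (rev (belast x p)) = x.
  by case: p {IHp} => [//|y p] /=; rewrite rev_cons last_rcons.
by rewrite /walk_length /= !big_cons big_nil addr0 addrC finset.setUC.
Qed.

Lemma tree_dist_le u p :
  path (@edge R T) u p -> tree_dist u (last u p) <= walk_length u p.
Proof.
move=> ep; apply: ge_inf; last by exists p.
by exists 0 => _ [q [eq _] <-]; exact: walk_length_ge0.
Qed.

Lemma le_tree_dist u v (r : R) :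
  (forall p, path (@edge R T) u p -> last u p = v -> r <= walk_length u p) ->
  r <= tree_dist u v.
Proof.
move=> rle; apply: lb_le_inf; last by move=> _ [p [ep lp] <-]; exact: rle.
have [_ _ _ /(_ u v) /connectP[p ep ->] _] := edge_tree T.
by exists (walk_length u p), p.
Qed.

Lemma tree_dist_ge0 u v : 0 <= tree_dist u v.
Proof. by apply: le_tree_dist => p ep _; exact: walk_length_ge0. Qed.

Lemma tree_distxx u : tree_dist u u = 0.
Proof.
apply/eqP; rewrite eq_le tree_dist_ge0 andbT.
by have := @tree_dist_le u [::] isT; rewrite /walk_length big_nil.
Qed.

Lemma tree_distC u v : tree_dist u v = tree_dist v u.
Proof.
have half x y : tree_dist x y <= tree_dist y x.
  apply: le_tree_dist => p ep <-; rewrite -walk_length_rev.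
  have -> : tree_dist (last y p) y =
            tree_dist (last y p) (last (last y p) (rev (belast y p))).
    by congr tree_dist; case: p {ep} => [//|z p] /=; rewrite rev_cons last_rcons.
  apply: tree_dist_le; rewrite rev_path.
  by rewrite (eq_path (e' := @edge R T)) // => a b; rewrite edgeC.
by apply/eqP; rewrite eq_le !half.
Qed.

Lemma tree_dist_triangle u v w :
  tree_dist u w <= tree_dist u v + tree_dist v w.
Proof.
rewrite -lerBlDr; apply: le_tree_dist => p ep lp.
rewrite lerBlDr addrC -lerBlDr; apply: le_tree_dist => q eq lq.
rewrite lerBlDr addrC -{1}lp -walk_length_cat.
have <- : last u (p ++ q) = w by rewrite last_cat lp.
by apply: tree_dist_le; rewrite cat_path ep lp.
Qed.

Lemma simple_path_inj u p q :
  path (@edge R T) u p -> path (@edge R T) u q -> uniq (u :: p) ->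
  uniq (u :: q) -> last u p = last u q -> p = q.
Proof.
have [_ _ _ _ acyc] := edge_tree T.
elim: p u q => [|x p IHp] u [|y q] //=.
- by move=> _ _ _ /andP[+ _] uE; rewrite uE mem_last.
- by move=> _ _ /andP[+ _] _ uE; rewrite -uE mem_last.
case/andP=> eux ep /andP[euy eq] /andP[up Up] /andP[uq Uq] lE.
have [xy|nxy] := eqVneq x y.
  by move: eq uq Uq lE; rewrite -xy => eq uq Uq lE; congr cons; exact: IHp ep eq Up Uq lE.
have hasq : has (mem (x :: p)) (y :: q).
  by apply/hasP; exists (last y q); rewrite ?mem_last // -lE /= mem_last.
have {eux ep} ep : path (@edge R T) u (x :: p) by rewrite /= eux.
have {euy eq} eq : path (@edge R T) u (y :: q) by rewrite /= euy.
have hd_neq z p1 p2 q1 q2 : x :: p = rcons p1 z ++ p2 -> y :: q = rcons q1 z ++ q2 ->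
    (0 < size p1 + size q1)%N.
  case: p1 q1 => [|? ?] [|? ?] //= [xz _] [yz _].
  by move: nxy; rewrite xz yz eqxx.
rewrite -!/(uniq (_ :: _)) in Up Uq.
move: (x :: p) (y :: q) hd_neq hasq ep eq up Up uq Uq => {IHp lE nxy}{}p {}q hd_neq hasq ep eqq up Up uq Uq.
case/split_find: hasq hd_neq eqq uq Uq => z q1 q2 /= zp q1p.
case/path.splitP: zp q1p ep up Up => p1 p2 q1p ep up Up hd_neq eq uq Uq.
have /acyc : ucycle (@edge R T) (u :: rcons p1 z ++ rev q1).
  apply/andP; split.
    move: ep eq; rewrite /= !cat_path => /andP[ep _] /andP[eq _].
    rewrite rcons_cat cat_path ep last_rcons /=.
    have -> : rcons (rev q1) u = rev (belast u (rcons q1 z)).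
      by rewrite belast_rcons rev_cons.
    rewrite -{1}(last_rcons u q1 z) rev_path.
    by rewrite (eq_path (e' := @edge R T)) // => a b; rewrite edgeC.
  move: up Up uq Uq; rewrite /= !mem_cat !mem_rev !cat_uniq !negb_or rev_uniq.
  move=> /andP[-> _] /andP[-> _] /andP[+ _] /andP[+ _].
  rewrite mem_rcons inE negb_or rcons_uniq => /andP[_ ->] /andP[_ ->].
  rewrite /= has_rev andbT; apply: contra q1p => /hasP[a aq ap].
  by apply/hasP; exists a => //; rewrite /= mem_cat ap.
rewrite /= size_cat size_rcons size_rev; have := hd_neq z p1 p2 q1 q2 erefl erefl.
by case: p1 {hd_neq q1p ep up Up} q1 {eq uq Uq} => [|? ?] [|? ?].
Qed.

Lemma tree_distE u p :
  path (@edge R T) u p -> uniq (u :: p) -> tree_dist u (last u p) = walk_length u p.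
Proof.
move=> ep Up; apply/eqP; rewrite eq_le tree_dist_le //=.
apply: le_tree_dist => q eq lq.
suff sle n q' v : (size q' <= n)%N -> path (@edge R T) v q' ->
    exists q0, [/\ path (@edge R T) v q0, uniq (v :: q0), last v q0 = last v q'
                 & walk_length v q0 <= walk_length v q'].
  have [q0 [eq0 Uq0 lq0 wq0]] := sle _ q u (leqnn _) eq.
  by rewrite (simple_path_inj ep eq0 Up Uq0) // lq0 lq.
elim: n q' v => [|n IHn] [|x r] v //=; try by exists [::].
rewrite ltnS => szr /andP[evx er].
have [vr|vNr] := boolP (v \in x :: r).
  have {evx er} er : path (@edge R T) v (x :: r) by rewrite /= evx.
  have szr' : (size (x :: r) <= n.+1)%N by [].
  rewrite -[last x r]/(last v (x :: r)).
  case/path.splitP: vr er szr' => r1 r2.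
  rewrite cat_path last_rcons size_cat size_rcons addSn ltnS => /andP[er1 er2] sz.
  have [q0 [e0 U0 l0 w0]] := IHn r2 v (leq_trans (leq_addl _ _) sz) er2.
  exists q0; split=> //; first by rewrite last_cat last_rcons.
  rewrite walk_length_cat last_rcons; apply: le_trans w0 _.
  by rewrite lerDr walk_length_ge0.
have [q0 [e0 U0 l0 w0]] := IHn r x szr er.
have [vq0|vNq0] := boolP (v \in x :: q0); last first.
  exists (x :: q0); split=> //=; [by rewrite evx | by rewrite vNq0 |].
  by rewrite /walk_length /= !big_cons lerD2l.
move: vq0; rewrite inE => /predU1P[vx|vq0].
  by move: vNr; rewrite vx inE eqxx.
case/path.splitP: vq0 e0 U0 l0 w0 => q1 q2.
rewrite cat_path last_rcons => /andP[e1 e2] U0 l0 w0.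
exists q2; split=> //.
- by move: U0; rewrite /= cat_uniq rcons_uniq mem_cat => /and3P[_ /andP[vq1 _] /andP[/hasPn N ->]]; rewrite andbT; apply/negP => /N; rewrite /= mem_rcons inE eqxx.
- by rewrite -l0 last_cat last_rcons.
rewrite -[X in _ <= X]add0r /walk_length /= big_cons -!/(walk_length _ _).
rewrite add0r; apply: le_trans (_ : walk_length x (rcons q1 v ++ q2) <= _).
  by rewrite walk_length_cat last_rcons lerDr walk_length_ge0.
by apply: le_trans w0 _; rewrite lerDr len_ge0.
Qed.

Definition dist0 u v : bool := tree_dist u v == 0.

Lemma dist0_refl : reflexive dist0.
Proof. by move=> u; rewrite /dist0 tree_distxx. Qed.

Lemma dist0_sym : symmetric dist0.
Proof. by move=> u v; rewrite /dist0 tree_distC. Qed.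

Lemma dist0_trans : transitive dist0.
Proof.
move=> v u w /eqP uv /eqP vw; rewrite /dist0 eq_le tree_dist_ge0 andbT.
by apply: le_trans (tree_dist_triangle u v w) _; rewrite uv vw addr0.
Qed.

Canonical dist0_equiv := EquivRel dist0 dist0_refl dist0_sym dist0_trans.

Definition tree_points : Type := {eq_quot dist0}%qT.

Definition points_dist (x y : tree_points) : R :=
  tree_dist (repr (x : {eq_quot dist0}%qT)) (repr (y : {eq_quot dist0}%qT)).

Lemma points_distE u v :
  points_dist (\pi_({eq_quot dist0}%qT) u)%qT (\pi_({eq_quot dist0}%qT) v)%qT
  = tree_dist u v.
Proof.
have D x : tree_dist x (repr (\pi_({eq_quot dist0}%qT) x)%qT) = 0.
  by apply/eqP; have := reprK (\pi_({eq_quot dist0}%qT) x)%qT;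
     move/eqquotP; rewrite /= dist0_sym.
rewrite /points_dist; apply/eqP; rewrite eq_le; apply/andP; split.
  apply: le_trans (tree_dist_triangle _ u _) _.
  rewrite tree_distC D add0r; apply: le_trans (tree_dist_triangle _ v _) _.
  by rewrite D addr0.
apply: le_trans (tree_dist_triangle _ (repr (\pi_({eq_quot dist0}%qT) u)%qT) _) _.
rewrite D add0r.
apply: le_trans (tree_dist_triangle _ (repr (\pi_({eq_quot dist0}%qT) v)%qT) _) _.
by rewrite [X in _ + X]tree_distC D addr0.
Qed.

End TreeMetric.

Arguments points_dist {R T}.

Section Distortion.
Context {R : realType}.

Definition l1_dist {k : nat} (a b : 'rV[R]_k) : R :=
  \sum_(i < k) `|a 0 i - b 0 i|.

Context {X Y : Type} (dX : X -> X -> R) (dY : Y -> Y -> R).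

(* The suprema are taken in [0, +oo]: adjoining 0 makes the supremum over the
   empty set (one-point spaces) equal to 0 instead of -oo. *)
Definition lip_norm (f : X -> Y) : \bar R :=
  ereal_sup (0%E |` [set r | exists x y : X,
    x <> y /\ r = (dY (f x) (f y) / dX x y)%:E]).

(* The Lipschitz norm of the inverse f(X) -> X, for injective f: two points of
   f(X) are f x and f y for unique x and y. *)
Definition lip_norm_inv (f : X -> Y) : \bar R :=
  ereal_sup (0%E |` [set r | exists x y : X,
    f x <> f y /\ r = (dX x y / dY (f x) (f y))%:E]).

Definition distortion (f : X -> Y) : \bar R :=
  if `[< injective f >] then (lip_norm f * lip_norm_inv f)%E else +oo%E.

End Distortion.

(* Main.v *)
(* Cutting the rooted tree into heavy paths describes a vertex by a word: the
   heavy paths met from the root, each with a prefix-free bit string as its name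
   and with the distance travelled on it.  Names are about as long as the
   logarithm of the drop in subtree size, so that a word costs O(log n) bits.
   At each scale s the distance travelled is cut into pieces of length h s, with
   h s.+1 = m.+1 * h s, and each piece is assigned to one coordinate.  Mass is
   only added along a path from the root, so the embedding is 1-Lipschitz.

   The scale at which a point of a path is placed is governed by a debt: at scale
   s, a bit of a name costs m * h s, and only the distance travelled free of debt
   at scale s is cut into pieces of length at least h s.  Hence low scales carry
   little mass, and the number of pieces and bits that are in use at scale s beyond
   a branching point is O(D / h s), where D is the distance travelled from there.

   The coordinate of a piece is read off a tree code (Schulman), applied to the
   string of the bits and pieces met so far at its scale.  Two branches then share
   a fraction O(1 / m) of their pieces of equal scale, and the overlap of pieces of
   different scales is O(D / m) because the heights grow by the factor m.+1.
   Scales s with m ^ 2 * h s * log n < D carry a negligible mass, so positions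
   in the strings matter only modulo O(m ^ 2 * log n).  With 4 * m ^ 2 symbols for
   each position and m of order 1 / eps this makes O(m ^ 4 * log n) coordinates. *)
Require Import Defs.
From mathcomp Require Import all_boot all_order all_algebra.
From mathcomp Require Import reals zify ring lra.
Set Implicit Arguments.
Unset Strict Implicit.
Unset Printing Implicit Defensive.
Import Order.TTheory GRing.Theory Num.Theory.
Local Open Scope ring_scope.

(** * Tree codes *)

Section TreeCode.
Variables (Q r : nat).
Hypothesis rE : r.+1 = (4 * Q)%N.
Local Notation sym := 'I_r.+1.
Implicit Types (t : seq {ffun 'I_Q -> sym}) (x y z : seq bool) (q : 'I_Q).

(* The convolution code whose generator is [t]: a one at distance [i] from
   the end of the string contributes [t`_i]. *)
Fixpoint conv t x q : sym :=
  if x is b :: x' then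
    (if b then nth [ffun=> 0] t (size x') q else 0) + conv t x' q
  else 0.

(** Entries of [t] are indexed from the end of the string, so the common prefix [z] adds the same
    symbol on both sides. *)
Lemma conv_cat t z x y q :
  size x = size y ->
  (conv t (z ++ x) q == conv t (z ++ y) q) = (conv t x q == conv t y q).
Proof.
move=> sxy; elim: z => [//|b z IHz] /=.
by rewrite !size_cat sxy (inj_eq (addrI _)).
Qed.

Lemma conv_rcons t c x q : (size x <= size t)%N ->
  conv (rcons t c) x q = conv t x q.
Proof.
elim: x => [//|b x IHx] /= sx; rewrite IHx ?(ltnW sx) //.
by rewrite nth_rcons sx.
Qed.

Definition agree t N x y : nat :=
  \sum_(j < N) \sum_q
    (conv t (true :: take j x) q == conv t (false :: take j y) q).

Lemma agree_rcons t c N x y : (N <= size t)%N ->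
  agree (rcons t c) N x y = agree t N x y.
Proof.
move=> Nt; apply: eq_bigr => j _; apply: eq_bigr => q _.
have jt : (j < size t)%N by apply: leq_trans (ltn_ord j) Nt.
have st u : (size (take j u) < size t)%N.
  by rewrite size_take_min (leq_ltn_trans (geq_minl _ _)).
by rewrite !conv_rcons //=.
Qed.

Lemma agreeS t N x y :
  agree t N.+1 x y = (agree t N (take N x) (take N y)
    + \sum_q (conv t (true :: take N x) q == conv t (false :: take N y) q))%N.
Proof.
rewrite /agree big_ord_recr /=; congr addn.
apply: eq_bigr => j _; apply: eq_bigr => q _.
by rewrite !take_takel // ltnW.
Qed.

Lemma symbol_pow_bound : ((r.+1 + 2) ^ Q <= 2 * r.+1 ^ Q)%N.
Proof.
have -> : (r.+1 + 2 = 2 * (2 * Q).+1)%N by rewrite rE; lia.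
have -> : r.+1 = (2 * (2 * Q))%N by rewrite rE; lia.
rewrite expnMn [in X in (_ <= X)%N]expnMn mulnCA leq_mul2l expn_eq0 /=.
have [Q0|Q0] := posnP Q; first by rewrite Q0.
(* This is [(1 + 1 / (2 * Q)) ^ k <= 1 / (1 - k / (2 * Q))] cleared of denominators; [k = Q] gives
   the factor 2. *)
have step k : ((2 * Q).+1 ^ k * (2 * Q - k) <= (2 * Q) ^ k.+1)%N.
  elim: k => [|k IHk]; first by rewrite !expnS !expn0; lia.
  rewrite !expnS; move: IHk; rewrite expnS.
  move: ((2 * Q).+1 ^ k)%N ((2 * Q) ^ k)%N => u v IHk.
  apply: leq_trans (leq_mul (leqnn (2 * Q)%N) IHk).
  have le : ((2 * Q).+1 * (2 * Q - k.+1) <= 2 * Q * (2 * Q - k))%N by nia.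
  by rewrite -mulnA mulnCA [X in (_ <= X)%N]mulnCA leq_mul2l le orbT.
rewrite -(leq_pmul2r Q0); have := step Q.
have -> : (2 * Q - Q = Q)%N by lia.
by rewrite expnS => le; rewrite (leq_trans le) // mulnAC.
Qed.

(** The sum factorises over [q]; in each factor one symbol agrees and contributes 3, while the other
    [r] contribute 1. *)
Lemma sum_agree_symbol (a b : 'I_Q -> sym) :
  (\sum_(c : {ffun 'I_Q -> sym}) 3 ^ (\sum_q ((c q + a q)%R == b q)))%N
  = ((r.+1 + 2) ^ Q)%N.
Proof.
transitivity (\sum_(c : {ffun 'I_Q -> sym}) \prod_q 3 ^ ((c q + a q)%R == b q))%N.
  by apply: eq_bigr => c _; rewrite expn_sum.
rewrite -(bigA_distr_bigA (fun q (c : sym) => 3 ^ ((c + a q)%R == b q))%N) /=.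
rewrite -[in RHS](card_ord Q) -prod_nat_const; apply: eq_bigr => q _.
rewrite (bigD1 (b q - a q)) //= subrK eqxx.
rewrite (eq_bigr (fun=> 1%N)) => [|c /eqP cN]; last first.
  by case: eqP => // E; case: cN; rewrite -E addrK.
rewrite sum1_card; have := cardC1 (b q - a q); rewrite card_ord.
by rewrite /predC1 /= => -> //=; lia.
Qed.

Fixpoint strings N : seq (seq bool) :=
  if N is N'.+1 then [seq rcons x b | x <- strings N', b <- [:: true; false]]
  else [:: [::]].

Lemma mem_strings N x : (x \in strings N) = (size x == N).
Proof.
elim: N x => [|N IHN] x; first by rewrite inE; case: x.
apply/allpairsP/eqP => [[[y b] /= [yN _ ->]]|].
  by move: yN; rewrite size_rcons IHN => /eqP ->.
case/lastP: x => [//|x b]; rewrite size_rcons => -[xN].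
by exists (x, b); rewrite IHN /= xN eqxx; split=> //; case: (b).
Qed.

Lemma sum_stringsS N (F : seq bool -> nat) :
  (\sum_(x <- strings N.+1) F (take N x))%N = (2 * \sum_(x <- strings N) F x)%N.
Proof.
rewrite [strings _]/(allpairs_dep _ _ _) big_allpairs_dep big_distrr /= big_seq [RHS]big_seq.
apply: eq_bigr => x; rewrite mem_strings => /eqP <-.
by rewrite !big_cons big_nil -!cats1 !take_size_cat // addn0 mul2n addnn.
Qed.

Definition weight t N : nat :=
  \sum_(x <- strings N) \sum_(y <- strings N) 3 ^ agree t N x y.

(* Averaging over the new entry [c]: two strings agree at each of the [Q] new
   symbols with probability 1 / (4 * Q), so the weight of a pair grows by the
   factor (1 + 2 / (4 * Q)) ^ Q <= 2, and there are 4 times as many pairs. *)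
Lemma weight_step t : exists c,
  (weight (rcons t c) (size t).+1 <= 8 * weight t (size t))%N.
Proof.
set N := size t.
have: (\sum_c weight (rcons t c) N.+1 <= \sum_(c : {ffun 'I_Q -> sym}) 8 * weight t N)%N.
  rewrite [X in (_ <= X)%N]sum_nat_const card_ffun !card_ord.
  pose hits (c : {ffun 'I_Q -> sym}) x y : nat :=
    (\sum_q ((c q + conv t x q)%R == conv t y q))%N.
  have E c : weight (rcons t c) N.+1 = (4 * \sum_(x <- strings N) \sum_(y <- strings N)
     3 ^ agree t N x y * 3 ^ hits c x y)%N.
    rewrite -[4%N]/(2 * 2)%N -mulnA big_distrr /=.
    under [in RHS]eq_bigr => x _ do rewrite -(sum_stringsS N
      (fun y => 3 ^ agree t N x y * 3 ^ hits c x y)%N).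
    rewrite -(sum_stringsS N (fun x => \sum_(y <- strings N.+1)
       3 ^ agree t N x (take N y) * 3 ^ hits c x (take N y))%N).
    rewrite /weight big_seq [RHS]big_seq; apply: eq_bigr => x.
    rewrite mem_strings => /eqP xN.
    rewrite big_seq [RHS]big_seq; apply: eq_bigr => y.
    rewrite mem_strings => /eqP yN.
    rewrite agreeS agree_rcons // expnD; congr (_ * 3 ^ _)%N.
    apply: eq_bigr => q _ /=.
    rewrite !conv_rcons ?size_takel ?xN ?yN // add0r.
    by rewrite nth_rcons ltnn eqxx.
  rewrite (eq_bigr _ (fun c _ => E c)) -big_distrr /= exchange_big /=.
  rewrite /weight mulnCA [X in (_ <= _ * X)%N]mulnC -[8%N]/(4 * 2)%N -!mulnA leq_mul2l /=.
  rewrite mulnCA big_distrl /=; apply: leq_sum => x _.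
  rewrite exchange_big big_distrl /=; apply: leq_sum => y _.
  by rewrite -big_distrr /= sum_agree_symbol leq_mul2l symbol_pow_bound orbT.
have [/existsP //|] := boolP [exists c, weight (rcons t c) N.+1 <= 8 * weight t N]%N.
rewrite negb_exists => /forallP H; rewrite leqNgt => /negP[].
rewrite (bigD1 [ffun=> 0]) //= [X in (_ < X)%N](bigD1 [ffun=> 0]) //=.
rewrite -addSn leq_add ?ltnNge ?H //.
by apply: leq_sum => c _; rewrite ltnW // ltnNge.
Qed.

(** Each pair contributes [3 ^ agree] to [weight], and [8 ^ N <= 3 ^ (2 * N)]. As [agree] up to [N]
    reads only the first [N] entries, extending the generator keeps the earlier bounds. *)
Lemma exists_generator D : exists2 t, size t = D &
  forall N x y, (N <= D)%N -> size x = N -> size y = N -> (agree t N x y <= 2 * N)%N.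
Proof.
suff [t tD W] : exists2 t, size t = D & forall N, (N <= D)%N -> (weight t N <= 8 ^ N)%N.
  exists t => // N x y ND xN yN; rewrite -(leq_exp2l (m := 3)) //.
  apply: leq_trans (_ : 8 ^ N <= _)%N; last first.
    by rewrite expnM; case: (N) => // n; rewrite leq_exp2r.
  apply: leq_trans (W N ND); rewrite /weight (big_rem x) ?mem_strings ?xN //=.
  by rewrite (big_rem y) ?mem_strings ?yN //= -addnA leq_addr.
elim: D => [|D [t tD W]].
  exists [::] => // -[|//] _; rewrite /weight /= !big_cons !big_nil.
  by rewrite /agree big_ord0.
have [c] := weight_step t; rewrite tD => Wc.
exists (rcons t c); first by rewrite size_rcons tD.
move=> N; rewrite leq_eqVlt => /predU1P[->|].
  by rewrite expnS (leq_trans Wc) // leq_mul2l W.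
rewrite ltnS => ND; apply: leq_trans (W N ND).
by apply: leq_sum => x _; apply: leq_sum => y _; rewrite agree_rcons ?tD.
Qed.

(* Schulman's tree codes, with [Q] symbols per edge. *)
Lemma exists_tree_code D : exists lam : seq bool -> 'I_Q -> sym,
  forall N z x y (b : bool), (N <= D)%N ->
  (\sum_(j < N | (j <= size x) && (j <= size y)) \sum_q
      (lam (z ++ b :: take j x) q == lam (z ++ ~~ b :: take j y) q) <= 2 * N)%N.
Proof.
have [t tD H] := exists_generator D; exists (conv t) => N z x y b ND.
wlog -> : x y b / b = true.
  move=> W; case: b; first exact: W.
  rewrite (eq_bigl _ _ (fun j => andbC _ _)).
  rewrite (eq_bigr (fun j : 'I_N => \sum_q (conv t (z ++ true :: take j y) q
     == conv t (z ++ ~~ true :: take j x) q))%N); first exact: W.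
  by move=> j _; apply: eq_bigr => q _; rewrite eq_sym.
pose pad u := take N (u ++ nseq N false).
have pN u : size (pad u) = N.
  by rewrite size_takel // size_cat size_nseq leq_addl.
apply: leq_trans (H N (pad x) (pad y) ND (pN x) (pN y)).
rewrite /agree big_mkcond /=; apply: leq_sum => j _.
case: ifP => // /andP[jx jy]; apply: leq_sum => q _.
have tE u : (j <= size u)%N -> take j (pad u) = take j u.
  move=> ju; rewrite /pad take_takel ?(ltnW (ltn_ord j)) //.
  by rewrite takel_cat.
by rewrite !tE // conv_cat //= !size_takel.
Qed.

End TreeCode.

(** * Words and debts *)

Section Words.
Variable R : archiRealFieldType.

Definition word := seq (seq bool * R).
Implicit Types (w : word) (g : seq bool * R) (e D z h : R) (P X : nat).

Definition cost w : nat := \sum_(g <- w) (size g.1).+1.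
Definition wlength w : R := \sum_(g <- w) g.2.
Definition nneg w : bool := all (fun g => 0 <= g.2) w.

Definition owed e D g : R := D + (size g.1).+1%:R * e.

(* Entering a segment incurs [e] per bit of its name, and travelling repays
   debt first. *)
Fixpoint debt e D w : R :=
  if w is g :: w' then debt e (owed e D g - Num.min g.2 (owed e D g)) w' else D.

Fixpoint paid e D w : R :=
  if w is g :: w' then
    Num.min g.2 (owed e D g) + paid e (owed e D g - Num.min g.2 (owed e D g)) w'
  else 0.

Lemma paid_debt e D w : paid e D w + debt e D w = D + (cost w)%:R * e.
Proof.
rewrite /cost; elim: w D => [|g w IHw] D /=.
  by rewrite big_nil mul0r addr0 add0r.
by rewrite -addrA IHw big_cons natrD /owed; ring.
Qed.

Lemma debt_cat e D w w' : debt e D (w ++ w') = debt e (debt e D w) w'.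
Proof. by elim: w D => //=. Qed.

Lemma paid_cat e D w w' :
  paid e D (w ++ w') = paid e D w + paid e (debt e D w) w'.
Proof. by elim: w D => [|g w IHw] D /=; rewrite ?add0r // IHw addrA. Qed.

Lemma wlength_cat w w' : wlength (w ++ w') = wlength w + wlength w'.
Proof. by rewrite /wlength big_cat. Qed.

Lemma owed_ge0 e D g : 0 <= e -> 0 <= D -> 0 <= owed e D g.
Proof. by move=> e0 D0; rewrite addr_ge0 // mulr_ge0. Qed.

Lemma unpaid_ge0 e D g : 0 <= owed e D g - Num.min g.2 (owed e D g).
Proof. by rewrite subr_ge0 ge_min lexx orbT. Qed.

Lemma debt_ge0 e D w : 0 <= D -> 0 <= debt e D w.
Proof. by elim: w D => [|g w IHw] D D0 //=; apply: IHw; exact: unpaid_ge0. Qed.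

Lemma paid_ge0 e D w : 0 <= e -> 0 <= D -> nneg w -> 0 <= paid e D w.
Proof.
move=> e0; elim: w D => [|g w IHw] D D0 //= /andP[g0 w0].
by rewrite addr_ge0 ?IHw ?unpaid_ge0 // le_min g0 owed_ge0.
Qed.

Lemma owed_le e e' D D' g : e <= e' -> D <= D' -> owed e D g <= owed e' D' g.
Proof. by move=> ee DD; rewrite lerD // ler_wpM2l. Qed.

Lemma unpaid_le (a b b' : R) : b <= b' -> b - Num.min a b <= b' - Num.min a b'.
Proof. by move=> bb; rewrite !minElt; case: ifP; case: ifP; lra. Qed.

Lemma min_le (a b b' : R) : b <= b' -> Num.min a b <= Num.min a b'.
Proof. by move=> bb; rewrite le_min ge_min lexx ge_min bb orbT. Qed.

Lemma debt_le e e' D D' w : e <= e' -> D <= D' -> debt e D w <= debt e' D' w.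
Proof.
move=> ee; elim: w D D' => [|g w IHw] D D' DD //=.
by apply: IHw; apply: unpaid_le; exact: owed_le.
Qed.

Lemma paid_le e e' D D' w : e <= e' -> D <= D' -> paid e D w <= paid e' D' w.
Proof.
move=> ee; elim: w D D' => [|g w IHw] D D' DD //=.
by apply: lerD; [apply: min_le|apply: IHw; apply: unpaid_le]; exact: owed_le.
Qed.

(** Each segment incurs at least [e], so a rate above the total length leaves no distance free of
    debt. Hence the payments at the top rate recover the whole length. *)
Lemma paid_wlength e D w : nneg w -> 0 <= D -> wlength w <= e -> paid e D w = wlength w.
Proof.
rewrite /wlength; elim: w D => [|g w IHw] D /=; first by rewrite big_nil.
move=> /andP[g0 w0] D0; rewrite big_cons => le.
have tw : 0 <= \sum_(j <- w) j.2.
  by rewrite big_seq sumr_ge0 // => j /(allP w0).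
have e0 : 0 <= e by rewrite (le_trans _ le) // addr_ge0.
rewrite IHw ?unpaid_ge0 //; last by rewrite (le_trans _ le) // lerDr.
congr (_ + _); apply/min_idPl; rewrite /owed.
rewrite -natr1 mulrDl mul1r.
by have := mulr_ge0 (ler0n R (size g.1)) e0; lra.
Qed.

(* While a debt accrued at rate [e] is repaid in full, the part of the payment
   that exceeds the one at the lower rate [e0] is proportional to the cost. *)
Lemma paid_gap e0 e D0 D w : 0 <= D0 -> D0 <= D -> debt e D w = 0 ->
  (e - e0) * (cost w)%:R <= paid e D w - paid e0 D0 w.
Proof.
move=> D00 DD d0; have := paid_debt e D w; have := paid_debt e0 D0 w.
by have := debt_ge0 e0 w D00; rewrite d0; lra.
Qed.

Lemma paid_gap_cat e0 e D0 D w w' : e0 <= e -> D0 <= D ->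
  paid e D w - paid e0 D0 w <= paid e D (w ++ w') - paid e0 D0 (w ++ w').
Proof.
move=> ee DD; rewrite !paid_cat.
have := paid_le w' ee (debt_le w ee DD); lra.
Qed.

(* The part in [n * h, (n + 1) * h] of a mass [z] stacked from [0] up. *)
Definition piece h z (n : nat) : R := Num.min z (n.+1%:R * h) - Num.min z (n%:R * h).

Lemma piece_ge0 h z n : 0 <= h -> 0 <= piece h z n.
Proof. by move=> h0; rewrite subr_ge0 min_le // ler_wpM2r // ler_nat. Qed.

Lemma piece_le h z n : 0 <= h -> piece h z n <= h.
Proof.
move=> h0; rewrite /piece -natr1 mulrDl mul1r; move: (n%:R * h) => a.
by rewrite !minElt; case: ifP; case: ifP; lra.
Qed.

Lemma piece_mono h z z' n : 0 <= h -> z <= z' -> piece h z n <= piece h z' n.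
Proof.
move=> h0 zz; rewrite /piece -natr1 mulrDl mul1r; move: (n%:R * h) => a.
by rewrite !minElt; do 4!case: ifP; lra.
Qed.

Lemma sum_piece h z a n :
  \sum_(i < n) piece h z (a + i) = Num.min z ((a + n)%:R * h) - Num.min z (a%:R * h).
Proof.
elim: n => [|n IHn]; first by rewrite big_ord0 addn0 subrr.
by rewrite big_ord_recr /= IHn /piece addnS; ring.
Qed.

Lemma piece_eq0 h z n : 0 <= h -> z <= n%:R * h -> piece h z n = 0.
Proof.
move=> h0 zn; rewrite /piece !(min_idPl _) ?subrr //.
by rewrite (le_trans zn) // ler_wpM2r // ler_nat.
Qed.

End Words.

(** * Placing the mass of one scale *)

Lemma big_shift (T : Type) (idx : T) (op : Monoid.law idx) (g : nat -> T) y n : (y < n)%N ->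
  \big[op/idx]_(P < n) (if (y < P)%N then g (P - y.+1)%N else idx)
  = \big[op/idx]_(j < n - y.+1) g j.
Proof.
move=> yn; rewrite -(big_mkord xpredT (fun P => if (y < P)%N then g (P - y.+1)%N else idx)).
rewrite (big_cat_nat _ (n := y.+1)) //= [X in op X _]big_nat_cond.
rewrite big1 ?Monoid.mul1m; last first.
  by move=> P /andP[/andP[_ Py] _]; rewrite ltnNge -ltnS Py.
rewrite -{1}[y.+1]add0n big_addn big_mkord; apply: eq_bigr => j _.
by rewrite addnK ifT // addnS ltnS leq_addl.
Qed.

Section Scale.
Variables (R : archiRealFieldType) (Q : nat) (h : R).
Hypotheses (Q0 : (0 < Q)%N) (h0 : 0 < h).
Local Notation e := (Q%:R * h).
Implicit Types (w : word R) (g : seq bool * R) (D z : R) (P X y q : nat).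

Lemma rate_gt0 : 0 < e. Proof. by rewrite mulr_gt0 // ltr0n. Qed.
Lemma rate_ge0 : 0 <= e. Proof. exact: ltW rate_gt0. Qed.
Local Hint Resolve rate_gt0 rate_ge0 : core.

(* The number of positions, of [Q] pieces each, that the mass [z] takes up.
   It is positive even for [z = 0], so that the position in progress at a
   branching is never used by the branch. *)
Definition adv z : nat := (Num.truncn (z / e) + 1)%N.

Lemma adv_gt z : z < (adv z)%:R * e.
Proof. by rewrite -ltr_pdivrMr // /adv addn1 truncnS_gt. Qed.

Lemma adv_le z : 0 <= z -> (adv z)%:R * e <= z + e.
Proof.
move=> z0; rewrite /adv natrD mulrDl mul1r lerD2r -ler_pdivlMr //.
by rewrite truncn_le divr_ge0.
Qed.

Lemma adv_mono z z' : z <= z' -> (adv z <= adv z')%N.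
Proof. by move=> zz; rewrite /adv leq_add2r le_truncn // ler_wpM2r // invr_ge0. Qed.

Definition seg y z P q : R :=
  if (y < P)%N then piece h z ((P - y.+1) * Q + q) else 0.

Lemma seg_ge0 y z P q : 0 <= seg y z P q.
Proof. by rewrite /seg; case: ifP => // _; exact/piece_ge0/ltW. Qed.

Lemma seg_le y z P q : seg y z P q <= h.
Proof. by rewrite /seg; case: ifP => _; rewrite ?piece_le // ltW. Qed.

Lemma seg_mono y z z' P q : z <= z' -> seg y z P q <= seg y z' P q.
Proof. by move=> zz; rewrite /seg; case: ifP => // _; apply: piece_mono => //; exact: ltW. Qed.

Lemma seg_supp y z P q : seg y z P q != 0 -> (y < P <= y + adv z)%N.
Proof.
rewrite /seg; case: ifP => [yP|]; last by rewrite eqxx.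
apply: contraR; rewrite /= -ltnNge => lt; rewrite piece_eq0 ?ltW //.
apply: lt_le_trans (adv_gt z) _; rewrite mulrA -natrM ler_pM2r // ler_nat.
by rewrite (leq_trans _ (leq_addr _ _)) // leq_mul2r; apply/orP; right; lia.
Qed.

Lemma sum_seg y z Pm : 0 <= z -> (y + adv z < Pm)%N ->
  \sum_(P < Pm) \sum_(q < Q) seg y z P q = z.
Proof.
move=> z0 yz; have yP : (y < Pm)%N by apply: leq_ltn_trans yz; rewrite leq_addr.
pose G j := \sum_(q < Q) piece h z (j * Q + q).
transitivity (\sum_(P < Pm) (if (y < P)%N then G (P - y.+1)%N else 0)).
  apply: eq_bigr => P _; rewrite /seg; case: ifP => // _.
  by rewrite big1.
rewrite (big_shift _ G) // /G.
transitivity (\sum_(j < Pm - y.+1) (Num.min z (j.+1%:R * e) - Num.min z (j%:R * e))).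
  apply: eq_bigr => j _; rewrite sum_piece !natrM natrD -natr1 natrM.
  by congr (Num.min _ _ - Num.min _ _); ring.
have -> k : \sum_(j < k) (Num.min z (j.+1%:R * e) - Num.min z (j%:R * e))
    = Num.min z (k%:R * e).
  elim: k => [|k IHk]; first by rewrite big_ord0 mul0r; apply/esym/min_idPr.
  by rewrite big_ord_recr /= IHk; ring.
apply/min_idPl/ltW; apply: lt_le_trans (adv_gt z) _.
by rewrite ler_pM2r // ler_nat; lia.
Qed.

(* Apart from at most two, the pieces of height [h] lying between the masses
   [z] and [z'] are full. *)
Lemma sum_min_seg y z z' Pm (b : R) : 0 <= z -> z <= z' -> 0 <= b -> b <= h ->
  (y + adv z' < Pm)%N ->
  \sum_(P < Pm) \sum_(q < Q) Num.min b (seg y z' P q - seg y z P q)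
  <= b / h * (z' - z) + 2 * b.
Proof.
move=> z0 zz b0 bh yz.
have yz0 : (y + adv z < Pm)%N by apply: leq_ltn_trans yz; rewrite leq_add2l adv_mono.
pose hit (t : R) P q := (y < P)%N && ((P - y.+1) * Q + q == Num.truncn (t / h))%N.
have hit_le t : \sum_(P < Pm) \sum_(q < Q) (hit t P q)%:R <= 1 :> R.
  rewrite pair_big /= -natr_sum -[1]/(1%:R) ler_nat.
  have -> : (\sum_(p : 'I_Pm * 'I_Q) hit t p.1 p.2
      = #|[pred p : 'I_Pm * 'I_Q | hit t p.1 p.2]|)%N.
    rewrite -sum1_card [RHS]big_mkcond /=.
    by apply: eq_bigr => p _; rewrite -topredE /=; case: hit.
  apply/card_le1P => -[P q] /andP[/= yP /eqP n1] [P' q']; rewrite !inE /=.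
  apply/andP/eqP => [[yP' /eqP n2]|[-> ->]]; last by rewrite yP n1.
  have : ((P' - y.+1) * Q + q' = (P - y.+1) * Q + q)%N by rewrite n1 n2.
  move=> E.
  have Eq : (q' = q :> nat)%N by have := congr1 (modn^~ Q) E; rewrite !modnMDl !modn_small.
  have EP : (P' = P :> nat)%N.
    move: E; rewrite Eq => /eqP; rewrite eqn_add2r eqn_pmul2r // => /eqP; lia.
  by congr pair; apply: val_inj.
(* A piece cut by neither level differs by [0] or [h], and then the minimum is [b / h] times the
   difference; a cut piece costs at most [b]. *)
have bound P q : Num.min b (seg y z' P q - seg y z P q)
   <= b / h * (seg y z' P q - seg y z P q) + b * ((hit z P q)%:R + (hit z' P q)%:R).
  rewrite /seg /hit; case: ifP => yP /=; last first.
    by rewrite subrr !mulr0 addr0 mulr0 addr0 ge_min lexx orbT.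
  move: ((P - y.+1) * Q + q)%N => n.
  have full t : 0 <= t -> n != Num.truncn (t / h) -> t <= n%:R * h \/ n.+1%:R * h <= t.
    move=> t0; rewrite eq_sym truncn_eq ?divr_ge0 ?(ltW h0) //.
    rewrite negb_and -ltNge -leNgt => /orP[lt|le].
      by left; rewrite -ler_pdivrMr // ltW.
    by right; rewrite -ler_pdivlMr.
  have mu0 : 0 <= b / h by rewrite divr_ge0 // ltW.
  have mu1 : b / h * h = b by rewrite mulfVK // gt_eqF.
  set d := piece h z' n - piece h z n.
  have d0 : 0 <= d by rewrite subr_ge0 piece_mono // ltW.
  have [hz|hz] := eqVneq n (Num.truncn (z / h)).
    rewrite (le_trans (_ : _ <= b)) ?ge_min ?lexx //.
    have := mulr_ge0 mu0 d0; case: (n == _) => /=; rewrite ?mulr0n; lra.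
  have [hz'|hz'] := eqVneq n (Num.truncn (z' / h)).
    rewrite (le_trans (_ : _ <= b)) ?ge_min ?lexx //.
    have := mulr_ge0 mu0 d0; rewrite /= ?mulr0n; lra.
  rewrite /= !mulr0n addr0 mulr0 addr0.
  have P01 t : 0 <= t -> n != Num.truncn (t / h) -> piece h t n = 0 \/ piece h t n = h.
    move=> t0 /(full t t0)[le|le]; first by left; exact/piece_eq0/le/ltW.
    right; rewrite /piece !(min_idPr _) ?(le_trans _ le) ?ler_wpM2r ?ler_nat ?ltW //.
    by rewrite -natr1; ring.
  have z'0 := le_trans z0 zz.
  have [E|E] := P01 z' z'0 hz'; have [E'|E'] := P01 z z0 hz; move: d0; rewrite /d E E'.
  - by rewrite subrr mulr0 ge_min lexx orbT.
  - by move: h0; lra.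
  - by rewrite subr0 mu1 ge_min lexx.
  - by rewrite subrr mulr0 ge_min lexx orbT.
apply: le_trans (_ : _ <= \sum_(P < Pm) \sum_(q < Q)
  (b / h * (seg y z' P q - seg y z P q) + b * ((hit z P q)%:R + (hit z' P q)%:R))) _.
  by apply: ler_sum => P _; apply: ler_sum => q _; exact: bound.
under eq_bigr => P _ do rewrite big_split /= -!mulr_sumr sumrB big_split /=.
rewrite big_split /= -!mulr_sumr sumrB !sum_seg // ?(le_trans z0) //.
rewrite big_split /= lerD2l [X in _ <= X]mulrC ler_wpM2l //.
by have := hit_le z; have := hit_le z'; lra.
Qed.

Variable e1 : R.
Hypothesis ee1 : e <= e1.

(** The distance on this segment that is free of debt at rate [e] but still repays debt at rate
    [e1]. Successive rates cut the segment into such layers, one for each scale. *)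
Definition gain D D1 g : R :=
  Num.min g.2 (owed e1 D1 g) - Num.min g.2 (owed e D g).

(* The record of a word at one scale, with [D] and [D1] the debts at this scale
   and at the next one: [true] announces a name and [false] is a position. *)
Fixpoint str D D1 w : seq bool :=
  if w is g :: w' then
    true :: g.1 ++ nseq (adv (gain D D1 g)) false
      ++ str (owed e D g - Num.min g.2 (owed e D g))
             (owed e1 D1 g - Num.min g.2 (owed e1 D1 g)) w'
  else [::].

(* The mass of piece [q] of position [P], for a word that follows a record of
   length [X]. *)
Fixpoint place X D D1 w P q : R :=
  if w is g :: w' then
    seg (X + (size g.1).+1) (gain D D1 g) P q
    + place (X + (size g.1).+1 + adv (gain D D1 g))
            (owed e D g - Num.min g.2 (owed e D g))
            (owed e1 D1 g - Num.min g.2 (owed e1 D1 g)) w' P q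
  else 0.

Lemma str_cat D D1 w w' :
  str D D1 (w ++ w') = str D D1 w ++ str (debt e D w) (debt e1 D1 w) w'.
Proof. by elim: w D D1 => [|g w IHw] D D1 //=; rewrite IHw /= -!catA. Qed.

Lemma place_cat X D D1 w w' P q :
  place X D D1 (w ++ w') P q = place X D D1 w P q
    + place (X + size (str D D1 w)) (debt e D w) (debt e1 D1 w) w' P q.
Proof.
elim: w X D D1 => [|g w IHw] X D D1 /=; first by rewrite add0r addn0.
rewrite IHw addrA !size_cat size_nseq; congr (_ + place _ _ _ _ _ _); lia.
Qed.

Lemma gain_ge0 D D1 g : D <= D1 -> 0 <= gain D D1 g.
Proof. by move=> DD; rewrite subr_ge0; apply: min_le; exact: owed_le. Qed.

Lemma place_ge0 X D D1 w P q : 0 <= place X D D1 w P q.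
Proof. by elim: w X D D1 => [|g w IHw] X D D1 //=; rewrite addr_ge0 ?seg_ge0. Qed.

(** The lower bound clears the whole first name: branches with incomparable names have split before
    any mass is placed. *)
Lemma place_supp X D D1 w P q : place X D D1 w P q != 0 ->
  (X + (size (head [::] (map fst w))).+1 < P <= X + size (str D D1 w))%N.
Proof.
elim: w X D D1 => [|g w IHw] X D D1 /=; first by rewrite eqxx.
set r := seg _ _ P q; case: (eqVneq r 0) => [->|/seg_supp/andP[lt le] _]; last first.
  by apply/andP; split=> //; rewrite !size_cat size_nseq; move: le; lia.
rewrite add0r => /IHw/andP[lt le]; move: lt le; rewrite !size_cat size_nseq; lia.
Qed.

(** Distinct segments occupy disjoint ranges of positions, so at most one summand is non-zero. *)
Lemma place_le X D D1 w P q : place X D D1 w P q <= h.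
Proof.
elim: w X D D1 => [|g w IHw] X D D1 /=; first by rewrite ltW.
set r := seg _ _ P q; case: (eqVneq r 0) => [->|/seg_supp/andP[_ le]].
  by rewrite add0r.
set r' := place _ _ _ w P q; case: (eqVneq r' 0) => [->|/place_supp/andP[+ _]].
  by rewrite addr0 seg_le.
by move: le; lia.
Qed.

Lemma sum_place X D D1 w Pm : D <= D1 ->
  (X + size (str D D1 w) < Pm)%N ->
  \sum_(P < Pm) \sum_(q < Q) place X D D1 w P q = paid e1 D1 w - paid e D w.
Proof.
elim: w X D D1 => [|g w IHw] X D D1 DD /=.
  by move=> _; rewrite subrr big1 // => P _; rewrite big1.
rewrite !size_cat size_nseq => lt.
under eq_bigr => P _ do rewrite big_split /=.
rewrite big_split /= sum_seg ?gain_ge0 ?IHw //; first by rewrite /gain; ring.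
- by apply: unpaid_le; exact: owed_le.
- by move: lt; lia.
- by move: lt; lia.
Qed.

(** The factor 2 absorbs the one extra position per segment that [adv] reserves. *)
Lemma size_str D D1 w : D <= D1 ->
  (size (str D D1 w))%:R * e <= 2 * (cost w)%:R * e + (paid e1 D1 w - paid e D w).
Proof.
elim: w D D1 => [|g w IHw] D D1 DD /=; first by rewrite /cost big_nil; lra.
have DD' := unpaid_le g.2 (owed_le g ee1 DD).
have := IHw _ _ DD'; have := adv_le (gain_ge0 g DD).
rewrite /cost big_cons !size_cat size_nseq -/(cost w).
have -> a b c : (a + (b + c)).+1 = (a.+1 + b + c)%N by lia.
have c0 : e <= (size g.1).+1%:R * e by rewrite ler_peMl // ler1n.
rewrite !natrD /gain !mulrDl mulrDr mulrDl; lra.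
Qed.

Lemma place_nil_gain X D D1 w g P q : D <= D1 ->
  gain (debt e D w) (debt e1 D1 w) g = 0 ->
  place X D D1 (rcons w g) P q = place X D D1 w P q.
Proof.
move=> DD g0; rewrite -cats1 place_cat /= g0 addr0 [X in _ + X](_ : _ = 0) ?addr0 //.
by rewrite /seg; case: ifP => // _; rewrite piece_eq0 ?mulr_ge0 // ltW.
Qed.

(* After the last segment on which mass is gained, the debt at rate [e] is
   repaid, so that [paid_gap] bounds the length of the string in use. *)
Lemma extent X e0 D0 D D1 w : 0 <= D0 -> D0 <= D -> D <= D1 -> 0 <= e0 -> 2 * e0 <= e ->
  exists2 E : nat,
    (forall P q, place X D D1 w P q != 0 -> (P <= X + E)%N) &
    E%:R * e <= (paid e1 D1 w - paid e D w) + 4 * (paid e D w - paid e0 D0 w).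
Proof.
move=> D00 D0D DD e00 e0e.
have e0e' : e0 <= e by lra.
elim/last_ind: w => [|w g [E EP Ele]].
  by exists 0%N => [P q|]; rewrite /= ?eqxx // mul0r; lra.
have m1 := paid_gap_cat w [:: g] ee1 DD.
have m0 := paid_gap_cat w [:: g] e0e' D0D.
have DDw := debt_le w ee1 DD.
have [g0|gN0] := eqVneq (gain (debt e D w) (debt e1 D1 w) g) 0.
  exists E => [P q|]; first by rewrite place_nil_gain //; exact: EP.
  by rewrite -cats1; lra.
exists (size (str D D1 (rcons w g))) => [P q /place_supp/andP[]//|].
have d0 : debt e D (rcons w g) = 0.
  rewrite -cats1 debt_cat /=; apply/eqP; rewrite subr_eq0 eq_sym; apply/eqP/min_idPr.
  have := gain_ge0 g DDw; rewrite le_eqVlt eq_sym (negPf gN0) /= /gain.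
  have := owed_le g ee1 DDw; rewrite !minElt; do 2!case: ifP; lra.
(* Since [2 * e0 <= e], the term [2 * cost * e] of [size_str] is at most [4 * (e - e0) * cost],
   whence the 4. *)
have := paid_gap e0 D00 D0D d0; have := size_str (rcons w g) DD.
have := ler_wpM2r (ler0n R (cost (rcons w g))) e0e.
by lra.
Qed.

End Scale.

(** * Two diverging branches at one scale *)

Definition incomparable (x y : seq bool) : Prop :=
  exists z x' y' (b : bool), x = z ++ b :: x' /\ y = z ++ ~~ b :: y'.

(** A branch that stops at the splitting point diverges from every other: names have to split only
    if both words enter a further heavy path. *)
Definition diverging (R : archiRealFieldType) (u v : word R) : Prop :=
  match u, v with
  | g :: _, g' :: _ => incomparable g.1 g'.1
  | _, _ => True
  end.

Section PairScale.
Variables (R : archiRealFieldType) (Q : nat) (h e1 : R).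
Hypotheses (Q0 : (0 < Q)%N) (h0 : 0 < h) (ee1 : Q%:R * h <= e1).
Local Notation e := (Q%:R * h).
Variables (p u v : word R) (k : seq bool) (a b : R).
Hypotheses (a0 : 0 <= a) (ab : a <= b) (uv : diverging u v).

Local Notation D := (debt e 0).
Local Notation D1 := (debt e1 0).
Local Notation str := (str Q h e1 0 0).
Local Notation place := (place Q h e1).
Let wa := rcons p (k, a).
Let wb := rcons p (k, b).
Let X := size (str wa).
Let X' := size (str wb).
Local Notation z t := (gain Q h e1 (D p) (D1 p) (k, t)).
Let y := (size (str p) + (size k).+1)%N.

Definition gap_mass P q : R := seg Q h y (z b) P q - seg Q h y (z a) P q.

Lemma debts_le w : D w <= D1 w.
Proof. exact: debt_le. Qed.

Lemma z_ge0 t : 0 <= z t.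
Proof. exact/gain_ge0/debts_le. Qed.

Lemma z_mono : z a <= z b.
Proof.
have := owed_le (k, a) ee1 (debts_le p).
rewrite /gain /owed /=; move: (D p + _) (D1 p + _) => o o1.
by rewrite !minElt; do 4!case: ifP; move: ab; lra.
Qed.

Lemma str_rcons t : str (rcons p (k, t)) = str p ++ true :: k ++ nseq (adv Q h (z t)) false.
Proof. by rewrite -cats1 str_cat //= cats0. Qed.

Lemma size_str_rcons t : size (str (rcons p (k, t))) = (y + adv Q h (z t))%N.
Proof. by rewrite str_rcons !size_cat /= size_cat size_nseq; rewrite /y; lia. Qed.

Lemma str_gap : str wb = str wa ++ nseq (adv Q h (z b) - adv Q h (z a)) false.
Proof.
by rewrite !str_rcons -catA cat_cons -catA -nseqD subnKC // adv_mono // z_mono.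
Qed.

Lemma window_le : (X <= X')%N.
Proof. by rewrite /X' str_gap size_cat leq_addr. Qed.

Lemma window_gap : (X' - X)%:R * e <= (z b - z a) + e.
Proof.
rewrite /X /X' !size_str_rcons subnDl natrB ?adv_mono ?z_mono // mulrBl.
by have := adv_le Q0 h0 (z_ge0 b); have := adv_gt Q0 h0 (z a); lra.
Qed.

Lemma gap_mass_ge0 P q : 0 <= gap_mass P q.
Proof. by rewrite subr_ge0 seg_mono // z_mono. Qed.

(** The position [X] itself is included, because [wa] may leave it partly filled and [wb] fills it
    further. Earlier positions agree for the two words: those on this segment are already full. *)
Lemma gap_mass_supp P q : (q < Q)%N -> gap_mass P q != 0 -> (X <= P <= X')%N.
Proof.
move=> qQ nz; apply/andP; split; last first.
  rewrite /X' size_str_rcons; apply: contraR nz; rewrite -ltnNge => lt.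
  have E t : t \in [:: a; b] -> seg Q h y (z t) P q = 0.
    move=> tab; apply/eqP; apply: contraLR lt => /(seg_supp Q0 h0)/andP[_ le].
    rewrite -leqNgt (leq_trans le) // leq_add2l.
    by move: tab; rewrite !inE => /orP[]/eqP-> //; apply: adv_mono => //; exact: z_mono.
  by rewrite /gap_mass !E ?inE ?eqxx ?orbT // subrr.
rewrite /X size_str_rcons; apply: contraR nz; rewrite -ltnNge => lt.
rewrite /gap_mass /seg; case: ifP => yP; last by rewrite subrr.
set n := (_ * _ + _)%N.
suff full t : z a <= t -> piece h t n = h by rewrite !full ?z_mono // subrr.
move=> le; have : n.+1%:R * h <= t.
  apply: le_trans le.
  have : ((P - y) * Q)%:R * h <= z a.
    rewrite natrM -mulrA.
    have PA : (P - y)%:R * e <= (adv Q h (z a) - 1)%:R * e.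
      by rewrite ler_pM2r ?rate_gt0 // ler_nat; lia.
    apply: le_trans PA _; rewrite /adv addnK -ler_pdivlMr ?rate_gt0 //.
    by rewrite truncn_le divr_ge0 ?z_ge0 // ltW ?rate_gt0.
  apply: le_trans; rewrite ler_pM2r // ler_nat /n.
  have -> : (P - y = (P - y.+1).+1)%N by lia.
  by rewrite mulSn -addnS addnC leq_add2r.
move=> le1; rewrite /piece !(min_idPr _) //; first by rewrite -natr1; ring.
by rewrite (le_trans _ le1) // ler_pM2r // ler_nat.
Qed.

(* Either [wb ++ v] places no mass beyond the common part, or the two strings
   split before [wa ++ u] places any. *)
Lemma str_split : u <> [::] ->
  (forall P q, (q < Q)%N -> gap_mass P q + place X' (D wb) (D1 wb) v P q != 0 -> (P <= X)%N) \/
  exists x x1 x2 (c : bool),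
    [/\ str (wa ++ u) = x ++ c :: x1, str (wb ++ v) = x ++ ~~ c :: x2,
        (X <= size x)%N & (size x <= X + (size (head [::] (map fst u))))%N].
Proof.
case: u uv => [//|gu u'] uv' _ /=.
rewrite !str_cat // str_gap /=.
(* If [wb] takes further positions, it records [false] where [wa ++ u] announces a name by [true];
   otherwise the two names split. *)
set n := (adv Q h (z b) - _)%N; case En: n => [|n']; last first.
  right; exists (str wa); do 2!eexists; exists true; split=> //.
    by rewrite /= -catA.
  by rewrite leq_addr.
case: v uv' => [|gv v'] uv'.
  left=> P q qQ; rewrite addr0 => /gap_mass_supp -/(_ qQ)/andP[_].
  by rewrite /X' str_gap -/n En cats0.
case: uv' => x [x1 [x2 [c [Eu Ev]]]]; right.
exists (str wa ++ true :: x); do 2!eexists; exists c; split=> //=.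
- by rewrite Eu -catA /= -!catA.
- by rewrite Ev cats0 /= -!catA.
- by rewrite size_cat leq_addr.
- by rewrite size_cat Eu size_cat /= -/X; lia.
Qed.

Lemma place_gap P q : place 0 0 0 wb P q = place 0 0 0 wa P q + gap_mass P q.
Proof.
rewrite /wa /wb -!cats1 !place_cat //= !addr0 !add0n /gap_mass /y.
ring.
Qed.

Local Notation Ow := (D p + (size k).+1%:R * e).
Local Notation Ow1 := (D1 p + (size k).+1%:R * e1).

(** If neither [a] nor [b] lies strictly between the two thresholds, a non-zero gap covers the whole
    interval and is at least [h]; the error [2 * B] of [sum_min_seg] is then absorbed, turning the
    coefficient 1 into 3. Otherwise the last term pays for it. *)
Lemma sum_min_gap_mass Pm (B : R) : 0 <= B -> B <= h -> h <= e1 - e -> (X' < Pm)%N ->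
  \sum_(P < Pm) \sum_(q < Q) Num.min B (gap_mass P q)
  <= 3 * (B / h) * (z b - z a) + 2 * B * ((Ow < a < Ow1)%R + (Ow < b < Ow1)%R)%:R.
Proof.
move=> B0 Bh he1; rewrite /X' size_str_rcons => X'P.
have := z_mono; rewrite le_eqVlt => /predU1P[zE|zlt].
  rewrite /gap_mass zE subrr mulr0 add0r; apply: le_trans (_ : _ <= 0) _.
    by rewrite big1 // => P _; rewrite big1 // => q _; rewrite subrr; apply/min_idPr.
  by rewrite !mulr_ge0.
have := sum_min_seg Q0 h0 (z_ge0 a) (ltW zlt) B0 Bh X'P.
have mu0 : 0 <= B / h by rewrite divr_ge0 // ltW.
have Ow_le : Ow + h <= Ow1.
  have c1 : (1 : R) <= (size k).+1%:R by rewrite ler1n.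
  have hh := ltW h0; have := debts_le p; have := ler_pM2r h0 1 (size k).+1%:R.
  have : 1 * (e1 - e) <= (size k).+1%:R * (e1 - e) by rewrite ler_wpM2r // (le_trans hh).
  by lra.
have Bmu : B = B / h * h by rewrite mulfVK // gt_eqF.
have m0 : 0 <= B / h * (z b - z a) by rewrite mulr_ge0 // subr_ge0 ltW.
set ex := (_ + _)%N => le; have [ex0|ex1] := posnP ex; last first.
  have : 2 * B * 1 <= 2 * B * ex%:R by rewrite ler_wpM2l ?mulr_ge0 // ler1n.
  by move: le; rewrite -/(gap_mass _ _); lra.
suff : h <= z b - z a.
  move/(ler_wpM2l mu0); rewrite -Bmu ex0 mulr0.
  by move: le; lra.
move: ex0 zlt; rewrite /ex /gain /owed /=.
move: Ow Ow1 Ow_le => o o1 oo1.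
case: (ltP o a); case: (ltP a o1); case: (ltP o b); case: (ltP b o1) => //= ? ? ? ? _.
all: lra.
Qed.

End PairScale.

(** * Overlap of two branches *)

Section Overlap.
Variable R : realFieldType.

Lemma min_addl (x y z : R) : 0 <= x -> 0 <= y -> 0 <= z ->
  Num.min (x + y) z <= Num.min x z + Num.min y z.
Proof. by move=> x0 y0 z0; rewrite !minElt; do 3!case: ifP; lra. Qed.

Lemma min_suml (I : finType) (P : pred I) (F : I -> R) (z : R) :
  (forall i, P i -> 0 <= F i) -> 0 <= z ->
  Num.min (\sum_(i | P i) F i) z <= \sum_(i | P i) Num.min (F i) z.
Proof.
move=> F0 z0.
pose K (x y : R) := 0 <= x /\ Num.min x z <= y.
suff [] : K (\sum_(i | P i) F i) (\sum_(i | P i) Num.min (F i) z) by [].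
apply: (big_ind2 K) => [|x y x' y' [x0 xy] [x'0 xy']|i Pi].
- by rewrite /K lexx ge_min lexx.
- by split; [exact: addr_ge0|apply: le_trans (min_addl x0 x'0 z0) (lerD xy xy')].
- by rewrite /K F0.
Qed.

Lemma min_sum (I J : finType) (P : pred I) (P' : pred J) (F : I -> R) (G : J -> R) :
  (forall i, 0 <= F i) -> (forall j, 0 <= G j) ->
  Num.min (\sum_(i | P i) F i) (\sum_(j | P' j) G j)
  <= \sum_(i | P i) \sum_(j | P' j) Num.min (F i) (G j).
Proof.
move=> F0 G0; apply: le_trans (min_suml _ _) _ => //; first exact: sumr_ge0.
apply: ler_sum => i _; rewrite minC.
by under [leRHS]eq_bigr => j _ do rewrite minC; apply: min_suml.
Qed.

Variables (I C : finType) (cu cv : I -> C) (mu mv : I -> R).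
Hypotheses (mu0 : forall i, 0 <= mu i) (mv0 : forall i, 0 <= mv i).

Lemma sum_pushforward (P : pred I) (c : I -> C) (f : I -> R) :
  \sum_x \sum_(i | P i && (c i == x)) f i = \sum_(i | P i) f i.
Proof. by rewrite (partition_big c xpredT). Qed.

Lemma pushforward_dist_le :
  \sum_x `|\sum_(i | cu i == x) mu i - \sum_(i | cv i == x) mv i|
  <= \sum_i mu i + \sum_i mv i.
Proof.
rewrite -(sum_pushforward xpredT cu) -(sum_pushforward xpredT cv) -big_split /=.
apply: ler_sum => x _; apply: le_trans (ler_normB _ _) _.
by rewrite !ger0_norm ?sumr_ge0.
Qed.

(** In each coordinate [|A - B| = A + B - 2 * min A B], and the minimum of two sums is at most the
    sum of the pairwise minima. Mass outside [hi] is subtracted as a loss, whatever it overlaps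
    with. *)
Lemma pushforward_dist_ge (hi : pred I) :
  \sum_(i | hi i) (mu i + mv i) - \sum_(i | ~~ hi i) (mu i + mv i)
    - 2 * (\sum_(i | hi i) \sum_(j | hi j && (cu i == cv j)) Num.min (mu i) (mv j))
  <= \sum_x `|\sum_(i | cu i == x) mu i - \sum_(i | cv i == x) mv i|.
Proof.
have ovE : \sum_(i | hi i) \sum_(j | hi j && (cu i == cv j)) Num.min (mu i) (mv j)
   = \sum_x \sum_(i | hi i && (cu i == x)) \sum_(j | hi j && (cv j == x))
       Num.min (mu i) (mv j).
  rewrite -(sum_pushforward hi cu); apply: eq_bigr => x _.
  apply: eq_bigr => i /andP[_ /eqP->]; apply: eq_bigl => j; by rewrite [x == _]eq_sym.
rewrite ovE !big_split /= -(sum_pushforward hi cu mu) -(sum_pushforward hi cv mv).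
rewrite -(sum_pushforward (predC hi) cu mu) -(sum_pushforward (predC hi) cv mv) /=.
rewrite -!big_split /= -sumrB mulr_sumr -sumrB; apply: ler_sum => x _.
have := min_sum (fun i => hi i && (cu i == x)) (fun j => hi j && (cv j == x)) mu0 mv0.
have split c (f : I -> R) : \sum_(i | c i == x) f i =
    \sum_(i | hi i && (c i == x)) f i + \sum_(i | ~~ hi i && (c i == x)) f i.
  rewrite (bigID hi) /=; congr (_ + _); apply: eq_bigl => i; exact: andbC.
rewrite (split cu) (split cv).
have : 0 <= \sum_(i | hi i && (cu i == x)) mu i by exact: sumr_ge0.
have : 0 <= \sum_(i | hi i && (cv i == x)) mv i by exact: sumr_ge0.
have : 0 <= \sum_(i | ~~ hi i && (cu i == x)) mu i by exact: sumr_ge0.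
have : 0 <= \sum_(i | ~~ hi i && (cv i == x)) mv i by exact: sumr_ge0.
move: (\sum_(i | hi i && _) \sum_(j | _) _) => o.
do 4!move: (\sum_(i | _) _); move=> ah bh al bl bl0 al0 bh0 ah0.
have := ler_norm (ah + al - (bh + bl)); have := ler_norm (- (ah + al - (bh + bl))).
by rewrite normrN; case: (leP ah bh); lra.
Qed.

End Overlap.

Lemma sum_min_matched (R : realFieldType) (I J : finType) (K : I -> J -> bool) (f : I -> R)
    (g : J -> R) (B : R) :
  0 <= B -> (forall i, 0 <= f i <= B) -> (forall j, 0 <= g j) ->
  (forall i i' j, K i j -> K i' j -> f i != 0 -> f i' != 0 -> i = i') ->
  \sum_i \sum_(j | K i j) Num.min (f i) (g j) <= \sum_j Num.min B (g j).
Proof.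
move=> B0 fB g0 inj; rewrite (exchange_big_dep xpredT) //=; apply: ler_sum => j _.
have [/existsP[i /andP[Kij fi]]|] := boolP [exists i, K i j && (f i != 0)]; last first.
  rewrite negb_exists => /forallP none; rewrite big1 => [|i Kij].
    by rewrite le_min B0 g0.
  by have := none i; rewrite Kij negbK => /eqP ->; apply/min_idPl.
rewrite (bigD1 i) //= big1 ?addr0 => [|i' /andP[Ki'j ne]].
  by rewrite le_min !ge_min; have /andP[_ ->] := fB i; rewrite lexx orbT.
have [->|fi'] := eqVneq (f i') 0; first exact/min_idPl.
by move: ne; rewrite (inj i' i j) ?eqxx.
Qed.

(** * Counting windows, geometric sums and crossings *)

Section Count.
Variable R : archiRealFieldType.

Lemma count_window (Pm Q X E : nat) :
  \sum_(P < Pm) \sum_(q < Q) (X < P <= X + E)%N%:R <= (Q * E)%:R :> R.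
Proof.
rewrite (eq_bigr (fun P : 'I_Pm => Q%:R * (X < P <= X + E)%N%:R)); last first.
  by move=> P _; rewrite sumr_const card_ord mulr_natl.
rewrite -mulr_sumr natrM ler_wpM2l //.
have [XP|PX] := ltnP X Pm; last first.
  by rewrite big1 // => P _; rewrite ltnNge ltnW // (leq_trans (ltn_ord P)).
rewrite (eq_bigr (fun P : 'I_Pm => if (X < P)%N then (P - X.+1 < E)%N%:R else 0)); last first.
  move=> P _; case: ltnP => //= XP'; congr ((nat_of_bool _)%:R); lia.
rewrite (big_shift _ (fun j => (j < E)%N%:R) XP) -natr_sum ler_nat.
have: (\sum_(j < Pm - X.+1) (j < E) <= \sum_(j < Pm - X.+1 + E) (j < E))%N.
  rewrite -!(big_mkord xpredT (fun j => nat_of_bool (j < E)%N)).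
  by rewrite [X in (_ <= X)%N](big_cat_nat _ (n := Pm - X.+1)) ?leq_addr.
move/leq_trans; apply; rewrite -big_mkcond /=.
by rewrite -(big_ord_widen _ (fun=> 1%N)) ?leq_addl // sum1_card card_ord.
Qed.

Lemma sum_geometric (m : nat) (h : nat -> R) n : (forall s, h s.+1 = m.+1%:R * h s) ->
  m%:R * (\sum_(s < n) h s) = h n - h 0%N.
Proof.
move=> hS; elim: n => [|n IHn]; first by rewrite big_ord0 mulr0 subrr.
by rewrite big_ord_recr /= mulrDr IHn hS -natr1; ring.
Qed.

Lemma sum_between_le1 (o : nat -> R) (t : R) (S : nat) : (forall s, o s <= o s.+1) ->
  (\sum_(s < S) (o s < t < o s.+1)%R <= 1)%N.
Proof.
move=> oS; have omono i j : (i <= j)%N -> o i <= o j.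
  by move/subnKC <-; elim: (j - i)%N => [|n IHn]; rewrite ?addn0 // addnS (le_trans IHn).
have -> : (\sum_(s < S) (o s < t < o s.+1)%R = #|[pred s : 'I_S | (o s < t < o s.+1)%R]|)%N.
  by rewrite -sum1_card [RHS]big_mkcond; apply: eq_bigr => s _; rewrite -topredE /=; case: ifP.
apply/card_le1P => s /andP[os ts] s'; rewrite !inE.
apply/andP/eqP => [[os' ts']|-> //].
have [lt|lt|/val_inj //] := ltngtP s' s.
  by have := lt_trans (le_lt_trans (omono _ _ lt) os) ts'; rewrite ltxx.
by have := lt_trans (le_lt_trans (omono _ _ lt) os') ts; rewrite ltxx.
Qed.

End Count.

Lemma modn_window (L X P P' : nat) : (X <= P < X + L)%N -> (X <= P' < X + L)%N ->
  P = P' %[mod L] -> P = P'.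
Proof.
wlog le : P P' / (P <= P')%N => [W h h' E|].
  by have [le|/ltnW le] := leqP P P'; [exact: W|apply/esym; exact: W].
move=> /andP[XP _] /andP[_ P'X] /esym/eqP; rewrite eqn_mod_dvd // => d.
have : (P' - P < L)%N by lia.
by case: (posnP (P' - P)%N) => [|/dvdn_leq /(_ d)]; lia.
Qed.

(** * The embedding of words and the distance of two words *)

Section Embedding.
Variables (R : archiRealFieldType) (m r S Pm L : nat).
Variables (lam : seq bool -> 'I_m -> 'I_r.+1) (h : nat -> R).
Hypotheses (m0 : (0 < m)%N) (h0 : 0 < h 0%N) (hS : forall s, h s.+1 = m.+1%:R * h s).
Hypothesis code : forall N z x y (b : bool), (N <= Pm)%N ->
  (\sum_(j < N | (j <= size x) && (j <= size y)) \sum_q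
      (lam (z ++ b :: take j x) q == lam (z ++ ~~ b :: take j y) q) <= 2 * N)%N.

Local Notation rate s := (m%:R * h s).
Local Notation J := ('I_Pm * 'I_m)%type.
(** Taking positions modulo [L.+1] makes the number of coordinates independent of the lengths of the
    records. The code reads the record only up to the position, so a shared prefix yields shared
    sites. *)
Definition site (x : seq bool) (i : J) : 'I_L.+1 * 'I_m * 'I_r.+1 :=
  (inord (i.1 %% L.+1), i.2, lam (take i.1 x) i.2).

Local Notation lstr s := (str m (h s.+1) (rate s.+2) 0 0).
Local Notation lplace s := (place m (h s.+1) (rate s.+2)).

(* Scale [s] has pieces of height [h s.+1]: the debts of three consecutive rates
   enter the estimates, and the mass below rate [rate 1] is dropped. *)
Definition embed (w : word R) (c : 'I_L.+1 * 'I_m * 'I_r.+1) : R :=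
  \sum_(i : 'I_S * J | site (lstr i.1 w) i.2 == c) lplace i.1 0 0 0 w i.2.1 i.2.2.

Lemma height_gt0 s : 0 < h s.
Proof. by elim: s => [//|s IHs]; rewrite hS mulr_gt0. Qed.

Lemma height_le s t : (s <= t)%N -> h s <= h t.
Proof.
move/subnKC <-; elim: (t - s)%N => [|n IHn]; rewrite ?addn0 // addnS hS (le_trans IHn) //.
by rewrite ler_peMl ?ler1n // ltW // height_gt0.
Qed.

Lemma level_rate_ge0 s : 0 <= rate s.
Proof. by rewrite mulr_ge0 // ltW // height_gt0. Qed.

Lemma rate_le s t : (s <= t)%N -> rate s <= rate t.
Proof. by move=> st; rewrite ler_wpM2l // height_le. Qed.

Section Pair.
Variables (p u v : word R) (k : seq bool) (a b : R) (s0 : nat).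
Hypotheses (p0 : nneg p) (u0 : nneg u) (v0 : nneg v).
Hypotheses (a0 : 0 <= a) (ab : a <= b) (uv : diverging u v).
(* The two words leave the common part [wa]: one continues with mass [mu], the
   other one with [gap] on the shared heavy path and then with [mw]. *)
Let wa := rcons p (k, a).
Let wb := rcons p (k, b).
Let X s := size (lstr s wa).
Let X' s := size (lstr s wb).
Let mu s (i : J) : R :=
  lplace s (X s) (debt (rate s.+1) 0 wa) (debt (rate s.+2) 0 wa) u i.1 i.2.
Let gap s (i : J) : R := gap_mass m (h s.+1) (rate s.+2) p k a b i.1 i.2.
Let mw s (i : J) : R :=
  lplace s (X' s) (debt (rate s.+1) 0 wb) (debt (rate s.+2) 0 wb) v i.1 i.2.
Let mv s i : R := gap s i + mw s i.
Let H s := h s.+1.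

Let hs s : 0 < h s.+1. Proof. exact: height_gt0. Qed.

Let mS s : rate s.+1 <= rate s.+2. Proof. exact: rate_le. Qed.

Hypothesis fits : forall s, (s < S)%N ->
  (size (lstr s (wa ++ u)) < Pm)%N /\ (size (lstr s (wb ++ v)) < Pm)%N.

Lemma mu_ge0 s i : 0 <= mu s i.
Proof. exact: place_ge0. Qed.
Lemma mu_le s i : mu s i <= H s.
Proof. by apply: place_le. Qed.
Lemma gap_ge0 s i : 0 <= gap s i.
Proof. by apply: gap_mass_ge0. Qed.
Lemma mw_ge0 s i : 0 <= mw s i.
Proof. exact: place_ge0. Qed.
Lemma mv_ge0 s i : 0 <= mv s i.
Proof. by rewrite addr_ge0 ?gap_ge0 ?mw_ge0. Qed.

Lemma gap_supp s i : gap s i != 0 -> (X s <= i.1 <= X' s)%N.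
Proof. exact: (gap_mass_supp m0 (hs s) (mS s) a0 ab (ltn_ord i.2)). Qed.

Lemma mu_supp s i : mu s i != 0 ->
  (X s + (size (head [::] (map fst u))).+1 < i.1 <= size (lstr s (wa ++ u)))%N.
Proof. by move/(place_supp m0 (hs s) (mS s)); rewrite str_cat size_cat. Qed.

Lemma mw_supp s i : mw s i != 0 -> (X' s < i.1 <= size (lstr s (wb ++ v)))%N.
Proof.
by move/(place_supp m0 (hs s) (mS s)); rewrite str_cat size_cat -/(X' s); lia.
Qed.

Lemma mv_le s i : mv s i <= H s.
Proof.
rewrite /mv; have [->|nz] := eqVneq (mw s i) 0.
  rewrite addr0 /gap /gap_mass lerBlDr (le_trans (seg_le _ (hs s) _ _ _ _)) //.
  by rewrite lerDl seg_ge0.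
have [->|/gap_supp/andP[_ le]] := eqVneq (gap s i) 0.
  by rewrite add0r; apply: place_le.
by have := mw_supp nz; rewrite ltnNge le.
Qed.

(** [am s], [cm s] and [gm s] are what is repaid at [rate s] on [u], on [v] and on the shared path
    from [a] to [b]. Scale [s] carries their increments from [s.+1] to [s.+2], so that masses
    telescope over the scales. *)
Let am s := paid (rate s) (debt (rate s) 0 wa) u.
Let cm s := paid (rate s) (debt (rate s) 0 wb) v.
Let ow s := debt (rate s) 0 p + (size k).+1%:R * rate s.
Let gm s := Num.min b (ow s) - Num.min a (ow s).

Lemma sum_mu s : (s < S)%N -> \sum_i mu s i = am s.+2 - am s.+1.
Proof.
move=> /fits[sP _]; rewrite /mu.
rewrite -(pair_bigA _ (fun (P : 'I_Pm) (q : 'I_m) => lplace s _ _ _ u P q)) /=.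
apply: sum_place => //; first exact: debt_le.
by move: sP; rewrite str_cat size_cat.
Qed.

Lemma sum_mw s : (s < S)%N -> \sum_i mw s i = cm s.+2 - cm s.+1.
Proof.
move=> /fits[_ sP]; rewrite /mw.
rewrite -(pair_bigA _ (fun (P : 'I_Pm) (q : 'I_m) => lplace s _ _ _ v P q)) /=.
apply: sum_place => //; first exact: debt_le.
by move: sP; rewrite str_cat size_cat.
Qed.

Lemma X'_fits s : (s < S)%N -> (X' s < Pm)%N.
Proof.
by move=> /fits[_]; rewrite str_cat size_cat; apply: leq_ltn_trans; exact: leq_addr.
Qed.

Lemma gain_gap s :
  gain m (h s.+1) (rate s.+2) (debt (rate s.+1) 0 p) (debt (rate s.+2) 0 p) (k, b)
  - gain m (h s.+1) (rate s.+2) (debt (rate s.+1) 0 p) (debt (rate s.+2) 0 p) (k, a)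
  = gm s.+2 - gm s.+1.
Proof. by rewrite /gain /gm /owed /ow /=; ring. Qed.

Lemma sum_gap s : (s < S)%N -> \sum_i gap s i = gm s.+2 - gm s.+1.
Proof.
move=> /X'_fits sP.
rewrite -gain_gap /gap.
rewrite -(pair_bigA _ (fun (P : 'I_Pm) (q : 'I_m) => gap_mass m _ _ p k a b P q)) /=.
under eq_bigr => P _ do rewrite sumrB.
have := z_mono (mS s) p k ab.
have st t := size_str_rcons m0 (hs s) (mS s) p k a0 ab t.
have ge0 t := gain_ge0 (mS s) (k, t) (debt_le p (mS s) (lexx 0)).
move=> zab; rewrite sumrB !sum_seg // -?st //.
apply: leq_ltn_trans sP; exact: window_le.
Qed.

Lemma mu_extent s : exists2 E : nat,
  forall i, mu s i != 0 -> (X s < i.1 <= X s + E)%N &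
  E%:R * rate s.+1 <= am s.+2 - am s.+1 + 4 * (am s.+1 - am s).
Proof.
have r2 : 2 * rate s <= rate s.+1.
  by rewrite hS mulrCA ler_wpM2l // ler_wpM2r ?ler_nat // ltW // height_gt0.
have [E EP Ele] := extent m0 (hs s) (mS s) (X s) u (debt_ge0 (rate s) wa (lexx 0))
  (debt_le wa (rate_le (leqnSn s)) (lexx 0)) (debt_le wa (mS s) (lexx 0)) (level_rate_ge0 s) r2.
exists E => // i nz; rewrite (EP _ _ nz) andbT.
by have /andP[] := mu_supp nz; lia.
Qed.

Lemma mw_extent s : exists2 E : nat,
  forall i, mw s i != 0 -> (X' s < i.1 <= X' s + E)%N &
  E%:R * rate s.+1 <= cm s.+2 - cm s.+1 + 4 * (cm s.+1 - cm s).
Proof.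
have r2 : 2 * rate s <= rate s.+1.
  by rewrite hS mulrCA ler_wpM2l // ler_wpM2r ?ler_nat // ltW // height_gt0.
have [E EP Ele] := extent m0 (hs s) (mS s) (X' s) v (debt_ge0 (rate s) wb (lexx 0))
  (debt_le wb (rate_le (leqnSn s)) (lexx 0)) (debt_le wb (mS s) (lexx 0)) (level_rate_ge0 s) r2.
by exists E => // i nz; rewrite (EP _ _ nz) andbT; have /andP[] := mw_supp nz.
Qed.

(** A window of at most [L.+1] positions meets each residue at most once, so residue and piece
    number determine the piece. *)
Lemma site_inj (L0 Y : nat) x x' y (i i' j : J) :
  (L0 <= L)%N -> (Y <= i.1 <= Y + L0)%N -> (Y <= i'.1 <= Y + L0)%N ->
  site x i == site y j -> site x' i' == site y j -> i = i'.
Proof.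
move=> L0L iw iw' /eqP E /eqP E'.
have : (site x i).1 = (site x' i').1 by rewrite E E'.
case=> /(congr1 val); rewrite /= !inordK ?ltn_pmod // => EP Eq.
case: i i' iw iw' EP Eq {E E'} => [P q] [P' q'] /= iw iw' EP ->; congr pair.
by apply: val_inj; apply: (modn_window (X := Y)) EP; lia.
Qed.

Let su s := lstr s (wa ++ u).
Let sv s := lstr s (wb ++ v).
Let T s s' := \sum_i \sum_(j | site (su s) i == site (sv s') j) Num.min (mu s i) (mv s' j).

Section Bounds.
Variables (E E' : nat -> nat).
Hypotheses (Emu : forall s i, mu s i != 0 -> (X s < i.1 <= X s + E s)%N)
  (Emv : forall s i, mw s i != 0 -> (X' s < i.1 <= X' s + E' s)%N).

Lemma mv_supp s i : mv s i != 0 -> (X s <= i.1 <= X s + (X' s - X s + E' s))%N.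
Proof.
have XX : (X s <= X' s)%N by apply: window_le.
rewrite /mv; have [->|/Emv] := eqVneq (mw s i) 0; last by lia.
by rewrite addr0 => /gap_supp; lia.
Qed.

Lemma sum_min_count (f : J -> R) (B : R) (Y N : nat) : 0 <= B -> (forall i, 0 <= f i) ->
  (forall i, f i != 0 -> (Y < i.1 <= Y + N)%N) ->
  \sum_i Num.min B (f i) <= (m * N)%:R * B.
Proof.
move=> B0 f0 fs; rewrite mulrC.
apply: le_trans (_ : _ <= B * \sum_(i : J) (Y < i.1 <= Y + N)%N%:R) _.
  rewrite mulr_sumr; apply: ler_sum => i _.
  have [->|/fs ->] := eqVneq (f i) 0; last by rewrite mulr1 ge_min lexx.
  by rewrite (min_idPr _) // mulr_ge0.
rewrite ler_wpM2l // -(pair_bigA _ (fun (P : 'I_Pm) (q : 'I_m) => (Y < P <= Y + N)%N%:R)) /=.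
exact: count_window.
Qed.

(** Each of the at most [m * E s] pieces of the first word meets at most one piece of the second, of
    height at most [H s']. For [s' < s] this is small enough without the code. *)
Lemma overlap_down s s' : (X' s' - X s' + E' s' <= L)%N -> T s s' <= (m * E s)%:R * H s'.
Proof.
move=> wL; rewrite /T (exchange_big_dep xpredT) //=.
apply: le_trans (sum_min_count (ltW (hs s')) (@mu_ge0 s) (@Emu s)).
apply: le_trans (sum_min_matched (K := fun j i => site (su s) i == site (sv s') j)
  (ltW (hs s')) (f := mv s') _ (@mu_ge0 s) _).
- by apply: ler_sum => j _; apply: ler_sum => i _; rewrite minC.
- by move=> j; rewrite mv_ge0 mv_le.
move=> j j' i; rewrite ![site _ i == _]eq_sym => ij ij' /mv_supp wj /mv_supp wj'.
exact: site_inj wL wj wj' ij ij'.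
Qed.

(* The summand with [ow] accounts for the pieces on the shared heavy path that
   may be nearly empty; this happens at no more than two scales. *)
Lemma overlap_up s s' : (s < s')%N -> (s' < S)%N -> (E s <= L)%N ->
  T s s' <= (m * E' s')%:R * H s + 3 * (H s / H s') * (gm s'.+2 - gm s'.+1)
    + 2 * H s * (E s * ((ow s'.+1 < a < ow s'.+2)%R + (ow s'.+1 < b < ow s'.+2)%R))%:R.
Proof.
move=> ss sS EL.
have Hss : H s <= H s' by apply: height_le; rewrite ltnS ltnW.
have g0 : gm s'.+1 <= gm s'.+2.
  by rewrite -subr_ge0 -gain_gap subr_ge0; apply: z_mono.
have [E0|Epos] := posnP (E s).
  have -> : T s s' = 0.
    rewrite /T big1 // => i _; rewrite big1 // => j _.
    have -> : mu s i = 0.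
      by apply/eqP; apply: contraTT isT => /Emu; rewrite E0; lia.
    by apply/min_idPl; exact: mv_ge0.
  rewrite E0 mul0n mulr0 addr0 addr_ge0 ?mulr_ge0 ?invr_ge0 ?(ltW (hs _)) //.
  by rewrite subr_ge0.
apply: le_trans (sum_min_matched (ltW (hs s)) (f := mu s) (B := H s) _ (@mv_ge0 s') _) _.
- by move=> i; rewrite mu_ge0 mu_le.
- move=> i i' j ij ij' /Emu wi /Emu wi'.
  by apply: (site_inj (Y := X s) EL _ _ ij ij'); lia.
apply: le_trans (_ : _ <= \sum_j (Num.min (H s) (gap s' j) + Num.min (H s) (mw s' j))) _.
  apply: ler_sum => j _; rewrite !(minC (H s)).
  by apply: min_addl; rewrite ?gap_ge0 ?mw_ge0 // ltW // hs.
rewrite big_split /= addrC -addrA lerD //.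
  exact: sum_min_count (ltW (hs s)) (@mw_ge0 s') (@Emv s').
rewrite /gap -(pair_bigA _ (fun (P : 'I_Pm) (q : 'I_m) =>
  Num.min _ (gap_mass m _ _ p k a b P q))) /=.
have he : h s'.+1 <= rate s'.+2 - rate s'.+1.
  have m1 : (1 : R) <= m%:R by rewrite ler1n.
  rewrite -mulrBr (hS s'.+1) -natr1 mulrDl mul1r addrK mulrA.
  by rewrite ler_peMl ?(ltW (hs _)) // mulr_ege1.
apply: le_trans (sum_min_gap_mass m0 (hs s') (mS s') a0 ab (ltW (hs s)) Hss he (X'_fits sS)) _.
rewrite gain_gap lerD2l ler_wpM2l ?mulr_ge0 ?(ltW (hs _)) // ler_nat.
by rewrite leq_pmull.
Qed.

(** Equal sites at one scale force equal pieces, so only the code symbols matter; beyond the split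
    the tree code lets at most two of the [m] symbols per position agree on average. *)
Lemma overlap_same s : (s < S)%N -> (E s <= L)%N -> (X' s - X s + E' s <= L)%N ->
  T s s <= (2 * E s)%:R * H s.
Proof.
move=> sS EL E'L.
have [uE|/eqP uN] := eqVneq u [::].
  rewrite /T big1 ?mulr_ge0 ?(ltW (hs s)) // => i _; rewrite big1 // => j _.
  by rewrite /mu uE /=; apply/min_idPl; exact: mv_ge0.
pose hit (i : J) := [&& site (su s) i == site (sv s) i, mu s i != 0 & mv s i != 0].
have le1 : T s s <= \sum_i (hit i)%:R * H s.
  apply: ler_sum => i _; rewrite big_mkcond (bigD1 i) //= [X in _ + X]big1 ?addr0.
    rewrite /hit; case: eqP => _; last by rewrite mul0r.
    move: (mu_le s i); case: (eqVneq (mu s i) 0) => [E0|_].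
      by rewrite E0 mul0r ge_min lexx.
    case: (eqVneq (mv s i) 0) => [E0|_] le; first by rewrite E0 mul0r ge_min lexx orbT.
    by rewrite mul1r ge_min le.
  move=> j ji; case: ifP => // ij.
  have [->|/Emu wi] := eqVneq (mu s i) 0; first by apply/min_idPl; exact: mv_ge0.
  have [->|/mv_supp wj] := eqVneq (mv s j) 0; first by apply/min_idPr; exact: mu_ge0.
  by move: ji; rewrite (site_inj (Y := X s) (leqnn L) _ _ ij (eqxx _)) ?eqxx //; lia.
apply: le_trans le1 _; rewrite -mulr_suml ler_wpM2r ?(ltW (hs s)) //.
(* In the first alternative the second word places nothing beyond [X], where the mass of the first
   word has not begun. *)
have [none|[x [x1 [x2 [c [Eu Ev Xx xX]]]]]] := str_split m0 (hs s) (mS s) p k a0 ab uv uN.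
  rewrite big1 // => i _; rewrite /hit; case: and3P => //= -[_ /Emu wi /none].
  by move=> /(_ (ltn_ord _)); rewrite -/(X s); lia.
(* [g j] counts agreements [j] places after the splitting bit; position [P] reads a prefix of length
   [P], hence [j = P - (size x).+1]. The cap [Pm] keeps within the range of [code]. *)
pose g j := (if [&& (j < minn (E s) Pm)%N, (j <= size x1)%N & (j <= size x2)%N] then
  \sum_q (lam (x ++ c :: take j x1) q == lam (x ++ ~~ c :: take j x2) q) else 0)%N.
have hitg (P : 'I_Pm) :
    (\sum_q (hit (P, q)) <= if size x < P then g (P - (size x).+1) else 0)%N.
  have [|hit0] := boolP [exists q, hit (P, q)]; last first.
    rewrite big1 // => q _; apply/eqP; rewrite eqb0.
    by apply: contra hit0 => hq; apply/existsP; exists q.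
  case/existsP => q0 /and3P[_ mu0 mv0].
  have /andP[XP PE] := Emu mu0; have /andP[xP Ps] := mu_supp mu0.
  have Pv : (P <= size (sv s))%N.
    move: mv0; rewrite /mv; have [->|/mw_supp/andP[] //] := eqVneq (mw s (P, q0)) 0.
    rewrite addr0 => /gap_supp/andP[_ /leq_trans]; apply.
    by rewrite /sv str_cat size_cat leq_addr.
  have sxP : (size x < P)%N.
    by move: xP xX; rewrite /= /X /wa; lia.
  rewrite sxP /g ifT.
    apply: leq_sum => q _; case: (boolP (hit _)) => // /and3P[/eqP[EE] _ _].
    rewrite -(eqb_id true) lt0n eqb0 negbK; apply/eqP; move: EE.
    rewrite /su /sv Eu Ev !take_cat /= ltnNge ltnW //=.
    by rewrite -(subnSK sxP).
  move: Ps Pv PE Xx; rewrite /sv Eu Ev !size_cat /= -/(X s); have := ltn_ord P; lia.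
have gle : \sum_i (hit i)%:R
    <= (\sum_(P < Pm) if size x < P then g (P - (size x).+1) else 0)%N%:R :> R.
  rewrite -(pair_bigA _ (fun P q => (hit (P, q))%:R)) /= natr_sum.
  by apply: ler_sum => P _; rewrite -natr_sum ler_nat.
apply: le_trans gle _; rewrite ler_nat.
have [xP|Px] := ltnP (size x) Pm; last first.
  by rewrite big1 // => P _; rewrite ltnNge (leq_trans _ Px) // ltnW.
rewrite big_shift //.
apply: leq_trans (_ : \sum_(j < Pm) g j <= _)%N.
  rewrite -!(big_mkord xpredT g).
  by rewrite [X in (_ <= X)%N](big_cat_nat _ (n := Pm - (size x).+1)) ?leq_addr ?leq_subr.
have geE : (minn (E s) Pm <= Pm)%N by exact: geq_minr.
apply: leq_trans (_ : 2 * minn (E s) Pm <= _)%N; last by rewrite leq_mul2l geq_minl.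
apply: leq_trans (code x x1 x2 c geE).
rewrite (big_ord_widen_cond Pm (fun j => (j <= size x1)%N && (j <= size x2)%N)
  (fun j => \sum_q (lam (x ++ c :: take j x1) q == lam (x ++ ~~ c :: take j x2) q))%N geE).
rewrite [X in (_ <= X)%N]big_mkcond /=.
apply: leq_sum => j _; rewrite /g.
case: ifP => //; case: (_ < _)%N => //=.
by case: (_ <= size x1)%N => //=; case: (_ <= size x2)%N.
Qed.


(** The heights below scale [n] sum to at most [H n / m], which cancels the [m] pieces per position.
    The coefficient 7 is 2 from equal scales, 1 from [s' < s] and 4 from the exceptional scales, of
    which [a] and [b] cause at most one each. *)
Lemma overlap_total :
  (forall s, (s0 <= s)%N -> (s < S)%N -> (E s <= L)%N /\ (X' s - X s + E' s <= L)%N) ->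
  \sum_(s < S | (s0 <= s)%N) \sum_(s' < S | (s0 <= s')%N) T s s'
  <= 7 * (\sum_(s < S | (s0 <= s)%N) (E s)%:R * H s)
     + \sum_(s < S | (s0 <= s)%N) (E' s)%:R * H s
     + 3 / m%:R * (\sum_(s < S | (s0 <= s)%N) (gm s.+2 - gm s.+1)).
Proof.
move=> wL.
have H0 s : 0 <= H s by exact: ltW (hs s).
have mH (n : 'I_S) : m%:R * (\sum_(s < S | (s0 <= s)%N) (s < n)%N%:R * H s) <= H n.
  apply: le_trans (_ : m%:R * (\sum_(s < n) H s) <= _).
    rewrite ler_wpM2l // (big_ord_widen _ H (ltnW (ltn_ord n))) [X in X <= _]big_mkcond.
    rewrite [X in _ <= X]big_mkcond /=; apply: ler_sum => s _.
    by case: (s0 <= s)%N; case: (s < n)%N; rewrite ?mul1r ?mul0r ?lexx ?H0.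
  by rewrite (sum_geometric n (fun s => hS s.+1)) lerBlDr lerDl H0.
pose exc s := ((ow s.+1 < a < ow s.+2)%R + (ow s.+1 < b < ow s.+2)%R)%N.
pose G s := gm s.+2 - gm s.+1.
have G0 s : 0 <= G s by rewrite /G -gain_gap subr_ge0; apply: z_mono.
pose Tb s s' : R := (s == s' :> nat)%:R * (2 * ((E s)%:R * H s))
  + ((E s)%:R * (m%:R * ((s' < s)%N%:R * H s')))
  + ((E' s')%:R * (m%:R * ((s < s')%N%:R * H s))
     + 3 * (G s' / H s') * ((s < s')%N%:R * H s)
     + 2 * ((E s)%:R * H s) * (exc s')%:R).
have TTb s s' : (s0 <= s)%N -> (s < S)%N -> (s0 <= s')%N -> (s' < S)%N -> T s s' <= Tb s s'.
  move=> ss sS ss' sS'; have [EL _] := wL s ss sS; have [_ wL'] := wL s' ss' sS'.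
  have GH : 0 <= G s' / H s' by rewrite divr_ge0.
  have EH : 0 <= (E s)%:R * H s by rewrite mulr_ge0.
  have ex0 : 0 <= 2 * ((E s)%:R * H s) * (exc s')%:R by rewrite !mulr_ge0.
  rewrite /Tb; case: (ltngtP s s') => [lt|gt|E1] /=.
  - apply: le_trans (overlap_up lt sS' EL) _; rewrite -/(exc _) -/(G _) !natrM.
    by rewrite [H s / _]mulrC le_eqVlt; apply/orP; left; apply/eqP; rewrite /=; ring.
  - apply: le_trans (overlap_down _ wL') _; rewrite natrM.
    by move: ex0; rewrite !mul0r !mulr0; lra.
  - move: wL'; rewrite -E1 => wL'; apply: le_trans (overlap_same sS EL wL') _.
    by move: ex0; rewrite natrM -E1 !mul0r !mulr0; lra.
apply: le_trans (_ : _ <= \sum_(s < S | (s0 <= s)%N) \sum_(s' < S | (s0 <= s')%N) Tb s s') _.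
  by apply: ler_sum => s ss; apply: ler_sum => s' ss'; exact: TTb.
have exc2 (P : pred 'I_S) : \sum_(s < S | P s) (exc s)%:R <= 2 :> R.
  rewrite -natr_sum ler_nat big_mkcond /=.
  apply: leq_trans (_ : \sum_(s < S) exc s <= 2)%N; first by apply: leq_sum => s _; case: ifP.
  rewrite big_split /=.
  have inc s : ow s.+1 <= ow s.+2.
    by apply: lerD; [apply: debt_le|apply: ler_wpM2l] => //; exact: mS.
  have le1 t := sum_between_le1 (o := fun s => ow s.+1) t S inc.
  exact: leq_add (le1 a) (le1 b).
pose hi (s : 'I_S) := (s0 <= s)%N.
have -> : \sum_(s | hi s) \sum_(s' | hi s') Tb s s' =
    \sum_(s | hi s) \sum_(s' | hi s') (s == s' :> nat)%:R * (2 * ((E s)%:R * H s))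
  + \sum_(s | hi s) \sum_(s' | hi s') ((E s)%:R * (m%:R * ((s' < s)%N%:R * H s')))
  + (\sum_(s | hi s) \sum_(s' | hi s') ((E' s')%:R * (m%:R * ((s < s')%N%:R * H s)))
     + \sum_(s | hi s) \sum_(s' | hi s') (3 * (G s' / H s') * ((s < s')%N%:R * H s))
     + \sum_(s | hi s) \sum_(s' | hi s') (2 * ((E s)%:R * H s) * (exc s')%:R)).
  rewrite -!big_split; apply: eq_bigr => s _ /=; rewrite -!big_split.
  by apply: eq_bigr => s' _.
have A1 : \sum_(s | hi s) \sum_(s' | hi s') (s == s' :> nat)%:R * (2 * ((E s)%:R * H s))
    <= 2 * (\sum_(s | hi s) (E s)%:R * H s).
  rewrite mulr_sumr; apply: ler_sum => s ss; rewrite (bigD1 s) //= eqxx mul1r big1 ?addr0 //.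
  by move=> s' /andP[_ ne]; rewrite (inj_eq val_inj) eq_sym (negPf ne) mul0r.
have A2 : \sum_(s | hi s) \sum_(s' | hi s') ((E s)%:R * (m%:R * ((s' < s)%N%:R * H s')))
    <= \sum_(s | hi s) (E s)%:R * H s.
  apply: ler_sum => s _; rewrite -mulr_sumr ler_wpM2l // -mulr_sumr; exact: mH.
have A3 : \sum_(s | hi s) \sum_(s' | hi s') ((E' s')%:R * (m%:R * ((s < s')%N%:R * H s)))
    <= \sum_(s | hi s) (E' s)%:R * H s.
  rewrite exchange_big; apply: ler_sum => s _.
  by rewrite -mulr_sumr ler_wpM2l // -mulr_sumr; exact: mH.
have A4 : \sum_(s | hi s) \sum_(s' | hi s') (3 * (G s' / H s') * ((s < s')%N%:R * H s))
    <= 3 / m%:R * \sum_(s | hi s) G s.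
  rewrite exchange_big mulr_sumr; apply: ler_sum => s _; rewrite -mulr_sumr /=.
  have HN : H s != 0 by rewrite gt_eqF // hs.
  have mp : 0 < m%:R :> R by rewrite ltr0n.
  have c0 : 0 <= 3 * (G s / H s) by rewrite !mulr_ge0 ?invr_ge0.
  have := mH s; rewrite mulrC -ler_pdivlMr // => /(ler_wpM2l c0)/le_trans; apply.
  rewrite le_eqVlt; apply/orP; left; apply/eqP.
  by field; rewrite HN gt_eqF.
have A5 : \sum_(s | hi s) \sum_(s' | hi s') (2 * ((E s)%:R * H s) * (exc s')%:R)
    <= 4 * (\sum_(s | hi s) (E s)%:R * H s).
  rewrite mulr_sumr; apply: ler_sum => s _; rewrite -mulr_sumr.
  have EH : 0 <= (E s)%:R * H s by rewrite mulr_ge0.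
  by have := ler_wpM2l EH (exc2 hi); lra.
move: A1 A2 A3 A4 A5; rewrite /G /hi.
lra.
Qed.

End Bounds.

Lemma gm_mono s t : (s <= t)%N -> gm s <= gm t.
Proof.
move=> st; have : ow s <= ow t.
  by apply: lerD; [apply: debt_le|apply: ler_wpM2l] => //; exact: rate_le.
rewrite /gm; case: (leP b (ow s)); case: (leP b (ow t)); case: (leP a (ow s)).
all: by case: (leP a (ow t)); move: ab; lra.
Qed.

Lemma am_mono s t : (s <= t)%N -> am s <= am t.
Proof. by move=> st; rewrite paid_le ?debt_le ?rate_le. Qed.

Lemma cm_mono s t : (s <= t)%N -> cm s <= cm t.
Proof. by move=> st; rewrite paid_le ?debt_le ?rate_le. Qed.

Lemma am_ge0 s : 0 <= am s.
Proof. by rewrite paid_ge0 ?debt_ge0 ?level_rate_ge0. Qed.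

Lemma cm_ge0 s : 0 <= cm s.
Proof. by rewrite paid_ge0 ?debt_ge0 ?level_rate_ge0. Qed.

Lemma ow_ge0 s : 0 <= ow s.
Proof. by rewrite addr_ge0 ?debt_ge0 ?mulr_ge0 // ltW // height_gt0. Qed.

Lemma gm_ge0 s : 0 <= gm s.
Proof. by rewrite /gm; case: (leP b (ow s)); case: (leP a (ow s)); move: ab; lra. Qed.

Lemma gm_le s : gm s <= b - a.
Proof. by rewrite /gm; case: (leP b (ow s)); case: (leP a (ow s)); move: ab; lra. Qed.

Lemma paid_u s : paid (rate s) 0 (wa ++ u) = paid (rate s) 0 wa + am s.
Proof. by rewrite paid_cat. Qed.

Lemma paid_v s : paid (rate s) 0 (wb ++ v) = paid (rate s) 0 p + Num.min b (ow s) + cm s.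
Proof. by rewrite paid_cat; congr (_ + _); rewrite /wb -cats1 paid_cat /= addr0. Qed.

Lemma wa_nneg : nneg wa. Proof. by move: p0; rewrite /nneg all_rcons /= a0. Qed.

(** * Upper and lower bounds for the distance of one pair *)

Section Distance.
Variable Lc : nat.
Hypotheses (costu : (cost (wa ++ u) <= Lc)%N) (costv : (cost (wb ++ v) <= Lc)%N).
Hypotheses (totu : wlength (wa ++ u) <= rate S.+1) (totv : wlength (wb ++ v) <= rate S.+1).
Let Dd := b - a + wlength u + wlength v.
(** [low] makes the mass below scale [s0] an [O(1 / m)] fraction of [Dd]; [high] keeps the windows
    from scale [s0] on within [L]. *)
Hypotheses (low : m%:R * (rate s0.+1 * Lc%:R) <= Dd).
Hypotheses (high : Dd <= m%:R * (rate s0.+2 * Lc%:R)).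
Hypothesis LL : (5 * m * m.+1 * Lc + 1 <= L)%N.

Lemma cost_bound s w : (cost w <= Lc)%N -> paid (rate s) 0 w <= rate s * Lc%:R.
Proof.
move=> cw; have := paid_debt (rate s) 0 w; have := debt_ge0 (rate s) w (lexx 0).
have : (cost w)%:R * rate s <= Lc%:R * rate s by rewrite ler_wpM2r ?level_rate_ge0 // ler_nat.
by rewrite add0r [rate s * _]mulrC; lra.
Qed.

Lemma am_low : am s0.+1 <= rate s0.+1 * Lc%:R.
Proof.
apply: le_trans (cost_bound s0.+1 costu); rewrite paid_u lerDr.
by rewrite paid_ge0 ?level_rate_ge0 // wa_nneg.
Qed.

Lemma gcm_low : gm s0.+1 + cm s0.+1 <= rate s0.+1 * Lc%:R.
Proof.
apply: le_trans (cost_bound s0.+1 costv); rewrite paid_v lerD2r /gm.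
have := paid_ge0 (level_rate_ge0 s0.+1) (lexx 0) p0; have := ow_ge0 s0.+1.
by have := a0; case: (leP a (ow s0.+1)); lra.
Qed.

Lemma am_top : am S.+1 = wlength u.
Proof.
rewrite /am paid_wlength // ?debt_ge0 //; apply: le_trans totu.
by rewrite wlength_cat lerDr /wlength big_seq sumr_ge0 // => g /(allP wa_nneg).
Qed.

Lemma tot_p : 0 <= wlength p.
Proof. by rewrite /wlength big_seq sumr_ge0 // => g /(allP p0). Qed.

Lemma tot_u : 0 <= wlength u.
Proof. by rewrite /wlength big_seq sumr_ge0 // => g /(allP u0). Qed.

Lemma tot_v : 0 <= wlength v.
Proof. by rewrite /wlength big_seq sumr_ge0 // => g /(allP v0). Qed.

Lemma wlength_wbv : wlength (wb ++ v) = wlength p + b + wlength v.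
Proof. by rewrite wlength_cat /wb -cats1 wlength_cat /wlength big_seq1. Qed.

Lemma cm_top : cm S.+1 = wlength v.
Proof.
rewrite /cm paid_wlength // ?debt_ge0 //; apply: le_trans totv.
by rewrite wlength_wbv; have := tot_p; move: a0 ab; lra.
Qed.

Lemma gm_top : gm S.+1 = b - a.
Proof.
have : b <= ow S.+1.
  have := totv; rewrite wlength_wbv; have := tot_p; have := tot_v.
  have : rate S.+1 <= (size k).+1%:R * rate S.+1 by rewrite ler_peMl ?level_rate_ge0 // ler1n.
  have := debt_ge0 (rate S.+1) p (lexx 0); rewrite /ow; lra.
by move=> bo; rewrite /gm !(min_idPl _) // (le_trans ab).
Qed.

Lemma telescope_ge (f : nat -> R) : (forall s t, (s <= t)%N -> f s <= f t) ->
  f S.+1 - f s0.+1 <= \sum_(s < S | (s0 <= s)%N) (f s.+2 - f s.+1).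
Proof.
move=> fm; elim: (S) => [|n IHn].
  by rewrite big_ord0 subr_le0 fm.
rewrite big_mkcond big_ord_recr -big_mkcond /=.
case: ifP => [s0n|]; first by move: IHn; lra.
move/negbT; rewrite -ltnNge => ns0; rewrite addr0.
have le1 : f n.+2 <= f s0.+1 by rewrite fm.
apply: le_trans (_ : 0 <= _); first by rewrite subr_le0.
by rewrite sumr_ge0 // => s _; rewrite subr_ge0 fm.
Qed.

Lemma telescope_le (f : nat -> R) (P : pred 'I_S) : (forall s t, (s <= t)%N -> f s <= f t) ->
  \sum_(s < S | P s) (f s.+1 - f s) <= f S - f 0%N.
Proof.
move=> fm; apply: le_trans (_ : \sum_(s < S) (f s.+1 - f s) <= _).
  by rewrite big_mkcond; apply: ler_sum => s _; case: ifP; rewrite ?subr_ge0 ?fm.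
elim: (S) => [|n IHn]; first by rewrite big_ord0 subrr.
by rewrite big_ord_recr /=; move: IHn; lra.
Qed.

(** By the extents, [m] times the sum of [E s * H s] is at most 5 times the length of [u], and
    likewise for [v]; with the coefficient 7 this gives 35. *)
Lemma overlap_le :
  m%:R * (\sum_(s < S | (s0 <= s)%N) \sum_(s' < S | (s0 <= s')%N) T s s') <= 35 * Dd.
Proof.
have tight (f : nat -> J -> R) (Y : nat -> nat) (B : nat -> R) :
    (forall s, exists2 N : nat, forall i, f s i != 0 -> (Y s < i.1 <= Y s + N)%N &
       N%:R * rate s.+1 <= B s) ->
    exists2 E : nat -> nat, forall s i, f s i != 0 -> (Y s < i.1 <= Y s + E s)%N &
      forall s, (E s)%:R * rate s.+1 <= B s.
  move=> ex; exists (fun s => \max_(i | f s i != 0) (i.1 - Y s)%N) => s.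
    move=> i fi; have [N /(_ i fi)/andP[-> _] _] /= := ex s.
    by rewrite -leq_subLR (leq_bigmax_cond (F := fun i : J => (i.1 - Y s)%N) _ fi).
  have [N fN] := ex s; apply: le_trans; rewrite ler_wpM2r ?level_rate_ge0 // ler_nat.
  by apply/bigmax_leqP => i /fN/andP[_]; rewrite leq_subLR.
have [E Emu Ele] := tight _ _ _ mu_extent.
have [E' Emv E'le] := tight _ _ _ mw_extent.
have mp : 0 < m%:R :> R by rewrite ltr0n.
have tu := tot_u; have tv := tot_v.
(* The factor 5 in [LL] is [1 + 4] from the extents, and the added 1 is the rounding in
   [window_gap]. *)
have wL s : (s0 <= s)%N -> (s < S)%N -> (E s <= L)%N /\ (X' s - X s + E' s <= L)%N.
  move=> ss sS.
  have r0 : 0 < rate s.+1 by rewrite mulr_gt0.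
  have DL : Dd <= (m * m.+1 * Lc)%:R * rate s.+1.
    apply: le_trans high _; rewrite hS !natrM -!mulrA ler_pM2l //.
    rewrite [leLHS](_ : _ = m.+1%:R * Lc%:R * (m%:R * h s0.+1)); last by ring.
    by rewrite -mulrA ler_wpM2l // ler_wpM2l // rate_le.
  have Esmall (f : nat -> R) t N : (forall s t, (s <= t)%N -> f s <= f t) -> 0 <= f s ->
     f S.+1 = t -> t <= Dd -> N%:R * rate s.+1 <= f s.+2 - f s.+1 + 4 * (f s.+1 - f s) ->
     N%:R * rate s.+1 <= 5 * t.
    move=> fm f0 ft tD le; have := fm s s.+1 (leqnSn _); have := fm s.+1 s.+2 (leqnSn _).
    by have := fm s.+2 S.+1 sS; move: le; rewrite ft; lra.
  have Eu := Esmall am _ (E s) am_mono (am_ge0 s) am_top _ (Ele s).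
  have Ev := Esmall cm _ (E' s) cm_mono (cm_ge0 s) cm_top _ (E'le s).
  have {}Eu : (E s)%:R * rate s.+1 <= 5 * wlength u by apply: Eu; rewrite /Dd; move: ab; lra.
  have {}Ev : (E' s)%:R * rate s.+1 <= 5 * wlength v by apply: Ev; rewrite /Dd; move: ab; lra.
  have LL' N : N%:R * rate s.+1 <= 5 * Dd + rate s.+1 -> (N <= L)%N.
    move=> le; apply: leq_trans LL; rewrite -(ler_nat R) -(ler_pM2r r0) (le_trans le) //.
    have -> : (5 * m * m.+1 * Lc + 1)%:R * rate s.+1
        = 5 * ((m * m.+1 * Lc)%:R * rate s.+1) + rate s.+1.
      by rewrite natrD !natrM; ring.
    by rewrite lerD2r ler_wpM2l.
  split; apply: LL'; first by rewrite /Dd; move: ab; lra.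
  have : (X' s - X s)%:R * rate s.+1 <= _ := window_gap m0 (hs s) (mS s) p k a0 ab.
  rewrite gain_gap natrD; have := gm_ge0 s.+1; have := gm_le s.+2.
  by rewrite mulrDl /Dd; move: ab Ev tu tv; lra.
have le := overlap_total Emu Emv wL.
have := ler_wpM2l (ltW mp) le; move/le_trans; apply.
pose x := \sum_(s < S | (s0 <= s)%N) (E s)%:R * H s.
pose y := \sum_(s < S | (s0 <= s)%N) (E' s)%:R * H s.
pose z := \sum_(s < S | (s0 <= s)%N) (gm s.+2 - gm s.+1).
rewrite -/x -/y -/z.
have EH (F : nat -> nat) (f : nat -> R) :
   (forall s t, (s <= t)%N -> f s <= f t) -> 0 <= f 0%N ->
   (forall s, (F s)%:R * rate s.+1 <= f s.+2 - f s.+1 + 4 * (f s.+1 - f s)) ->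
   m%:R * (\sum_(s < S | (s0 <= s)%N) (F s)%:R * H s) <= 5 * f S.+1.
  move=> fm f0 Fle; rewrite mulr_sumr.
  apply: le_trans (_ : _ <= \sum_(s < S | (s0 <= s)%N) (f s.+2 - f s.+1 + 4 * (f s.+1 - f s))) _.
    by apply: ler_sum => s _; rewrite mulrCA; exact: Fle.
  rewrite big_split -mulr_sumr /=.
  have := telescope_le (f := f) (fun s => (s0 <= s)%N) fm.
  have := telescope_le (f := fun s => f s.+1) (fun s => (s0 <= s)%N) (fun s t st => fm s.+1 t.+1 st).
  have := fm 0%N 1%N isT; have := fm S S.+1 (leqnSn _); move: f0; lra.
have U : m%:R * x <= _ := EH E am am_mono (am_ge0 0) Ele.
have V : m%:R * y <= _ := EH E' cm cm_mono (cm_ge0 0) E'le.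
have Gs : z <= _ := telescope_le (f := fun s => gm s.+1) (fun s => (s0 <= s)%N)
  (fun s t st => gm_mono (st : (s.+1 <= t.+1)%N)).
have := gm_ge0 1; move: U V Gs; rewrite am_top cm_top gm_top /Dd.
have -> : m%:R * (7 * x + y + 3 / m%:R * z) = 7 * (m%:R * x) + m%:R * y + 3 * z.
  by field; rewrite gt_eqF.
by move: ab; lra.
Qed.

Lemma sum_levels (P : pred 'I_S) (F : nat -> J -> R) :
  \sum_(i : 'I_S * J | P i.1) F i.1 i.2 = \sum_(s | P s) \sum_i F s i.
Proof.
by rewrite (pair_big P xpredT (fun (s : 'I_S) i => F s i)) /=; apply: eq_bigl => i; rewrite andbT.
Qed.

Lemma overlap_levels :
  \sum_(i : 'I_S * J | (s0 <= i.1)%N)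
    \sum_(j : 'I_S * J | (s0 <= j.1)%N && (site (su i.1) i.2 == site (sv j.1) j.2))
      Num.min (mu i.1 i.2) (mv j.1 j.2)
  = \sum_(s < S | (s0 <= s)%N) \sum_(s' < S | (s0 <= s')%N) T s s'.
Proof.
rewrite (sum_levels (fun s => (s0 <= s)%N) (fun s i => \sum_(j : 'I_S * J |
    (s0 <= j.1)%N && (site (su s) i == site (sv j.1) j.2)) Num.min (mu s i) (mv j.1 j.2))).
apply: eq_bigr => s _; rewrite [RHS]exchange_big /=; apply: eq_bigr => i _.
by rewrite (pair_big_dep (fun s' : 'I_S => (s0 <= s')%N)
  (fun s' j => site (su s) i == site (sv s') j) (fun s' j => Num.min (mu s i) (mv s' j))).
Qed.

(** The mass of [wa] sits at sites read off the common part of the records, so both words place it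
    alike and it cancels. *)
Lemma embed_diff c : embed (wa ++ u) c - embed (wb ++ v) c
  = \sum_(i : 'I_S * J | site (su i.1) i.2 == c) mu i.1 i.2
    - \sum_(i : 'I_S * J | site (sv i.1) i.2 == c) mv i.1 i.2.
Proof.
pose base := \sum_(i : 'I_S * J | site (lstr i.1 wa) i.2 == c) lplace i.1 0 0 0 wa i.2.1 i.2.2.
have common w (s : 'I_S) (i : J) : lplace s 0 0 0 wa i.1 i.2 != 0 ->
    site (lstr s wa ++ w) i = site (lstr s wa) i.
  move/(place_supp m0 (hs s) (mS s))/andP => [_]; rewrite add0n => le.
  by rewrite /site takel_cat.
have baseE (y : nat -> seq bool) :
    \sum_(i : 'I_S * J | site (lstr i.1 wa ++ y i.1) i.2 == c)
       lplace i.1 0 0 0 wa i.2.1 i.2.2 = base.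
  rewrite /base big_mkcond [RHS]big_mkcond; apply: eq_bigr => -[s i] _ /=.
  have [E0|nz] := eqVneq (lplace s 0 0 0 wa i.1 i.2) 0; first by rewrite E0 !if_same.
  by rewrite (common _ _ _ nz).
have -> : embed (wa ++ u) c = base + \sum_(i : 'I_S * J | site (su i.1) i.2 == c) mu i.1 i.2.
  rewrite -(baseE (fun s => str m (h s.+1) (rate s.+2)
    (debt (rate s.+1) 0 wa) (debt (rate s.+2) 0 wa) u)).
  rewrite /embed /su.
  under eq_bigl => i do rewrite str_cat.
  under [X in _ = _ + X]eq_bigl => i do rewrite str_cat.
  by rewrite -big_split /=; apply: eq_bigr => i _; rewrite (place_cat m0 (hs i.1) (mS i.1)).
have -> : embed (wb ++ v) c = base + \sum_(i : 'I_S * J | site (sv i.1) i.2 == c) mv i.1 i.2.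
  have svE : exists y, forall s, sv s = lstr s wa ++ y s.
    exists (fun s => drop (size (lstr s wa)) (sv s)) => s.
    by rewrite /sv str_cat (str_gap m0 (hs s) (mS s) p k ab) -catA drop_size_cat.
  have [y yE] := svE; rewrite -(baseE y) /embed.
  under [X in _ = X + _]eq_bigl => i do rewrite -yE.
  rewrite -big_split /=; apply: eq_bigr => i _.
  rewrite (place_cat m0 (hs i.1) (mS i.1)) (place_gap m0 (hs i.1) (mS i.1) p k a b) -addrA.
  by [].
ring.
Qed.

(** The upper bound is the total mass. For the lower one, overlaps cost [2 * 35 / m] of [Dd], and
    the mass below scale [s0], at most [2 / m] of it, counts twice: it is missing from the main sum
    and subtracted once more. Now [70 + 4 = 74]. *)
Theorem embed_dist :
  (1 - 74 / m%:R) * Dd <= \sum_c `|embed (wa ++ u) c - embed (wb ++ v) c| <= Dd.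
Proof.
pose I := ('I_S * J)%type.
have muI (i : I) : 0 <= mu i.1 i.2 by exact: mu_ge0.
have mvI (i : I) : 0 <= mv i.1 i.2 by exact: mv_ge0.
have mp : 0 < m%:R :> R by rewrite ltr0n.
under eq_bigr => c _ do rewrite embed_diff.
have summu P : \sum_(i : I | P i.1) (mu i.1 i.2 + mv i.1 i.2) =
    \sum_(s < S | P s) (am s.+2 - am s.+1) + \sum_(s < S | P s) (gm s.+2 - gm s.+1)
    + \sum_(s < S | P s) (cm s.+2 - cm s.+1).
  rewrite (sum_levels P (fun s i => mu s i + mv s i)) -!big_split /=; apply: eq_bigr => s _.
  by rewrite big_split /= sum_mu // /mv big_split /= sum_gap // sum_mw // addrA.
have tam P := telescope_le (f := fun s => am s.+1) P
  (fun s t st => am_mono (st : (s.+1 <= t.+1)%N)).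
have tgm P := telescope_le (f := fun s => gm s.+1) P
  (fun s t st => gm_mono (st : (s.+1 <= t.+1)%N)).
have tcm P := telescope_le (f := fun s => cm s.+1) P
  (fun s t st => cm_mono (st : (s.+1 <= t.+1)%N)).
have D1 : am S.+1 + gm S.+1 + cm S.+1 = Dd by rewrite am_top gm_top cm_top /Dd; ring.
have := am_ge0 1; have := gm_ge0 1; have := cm_ge0 1 => c1 g1 a1.
apply/andP; split; last first.
  apply: le_trans (pushforward_dist_le _ _ muI mvI) _; rewrite -big_split /=.
  have := summu xpredT; have := tam xpredT; have := tgm xpredT; have := tcm xpredT.
  by rewrite -D1; lra.
apply: le_trans (pushforward_dist_ge
   (fun i : I => site (su i.1) i.2) (fun i : I => site (sv i.1) i.2) muI mvI (fun i : I => (s0 <= i.1)%N)).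
rewrite overlap_levels (summu (fun s : 'I_S => (s0 <= s)%N)).
rewrite (summu (fun s : 'I_S => ~~ (s0 <= s)%N)).
have lo (f : nat -> R) : (forall s t, (s <= t)%N -> f s <= f t) -> 0 <= f 1%N ->
   \sum_(s < S | ~~ (s0 <= s)%N) (f s.+2 - f s.+1) <= f s0.+1.
  move=> fm f1; have := telescope_ge fm.
  have := telescope_le (f := fun s => f s.+1) xpredT (fun s t st => fm s.+1 t.+1 st).
  by rewrite (bigID (fun s : 'I_S => (s0 <= s)%N)) /=; lra.
have := overlap_le; rewrite mulrC -ler_pdivlMr // mulrAC.
have := low; rewrite mulrC -ler_pdivlMr // => r1 ov.
have := lo am am_mono a1; have := lo gm gm_mono g1; have := lo cm cm_mono c1.
have := telescope_ge am_mono; have := telescope_ge gm_mono; have := telescope_ge cm_mono.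
have := am_low; have := gcm_low.
have -> : (1 - 74 / m%:R) * Dd = Dd - 74 * (Dd / m%:R) by ring.
move: r1 ov D1.
lra.
Qed.

End Distance.
End Pair.
End Embedding.

(** * Words of a tree *)

(* The words of two points of a tree split at their last common point, which
   lies on the last heavy path that both of them visit. *)
Definition word_metric (R : archiRealFieldType) (d : R) (u v : word R) : Prop :=
  exists p k a b u' v', [/\ u = rcons p (k, a) ++ u', v = rcons p (k, b) ++ v',
    diverging u' v' & d = `|a - b| + wlength u' + wlength v'].

Lemma diverging_sym (R : archiRealFieldType) (u v : word R) : diverging u v -> diverging v u.
Proof.
case: u v => [|g u] [|g' v] //= [z [x [y [b [-> ->]]]]].
by exists z, y, x, (~~ b); rewrite negbK.
Qed.

Lemma word_embedding (R : archiRealFieldType) (V : finType) (W : V -> word R)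
    (d : V -> V -> R) (m Lc : nat) :
  (0 < m)%N -> (0 < Lc)%N -> (forall x, nneg (W x)) -> (forall x, (cost (W x) <= Lc)%N) ->
  (forall x y, word_metric (d x y) (W x) (W y)) ->
  exists f : V -> 'I_(5 * m * m.+1 * Lc + 1).+1 * 'I_m * 'I_(4 * m) -> R,
    forall x y, 0 < d x y ->
      (1 - 74 / m%:R) * d x y <= \sum_c `|f x c - f y c| <= d x y.
Proof.
move=> m0 L0 W0 Wc Wd.
have -> : (4 * m = (4 * m).-1.+1)%N by rewrite prednK // muln_gt0.
set r := (4 * m).-1; have rE : r.+1 = (4 * m)%N by rewrite prednK // muln_gt0.
have mp : (0 : R) < m%:R by rewrite ltr0n.
have Lp : (0 : R) < Lc%:R by rewrite ltr0n.
pose dmin : R := \big[Num.min/1]_(p : V * V | 0 < d p.1 p.2) d p.1 p.2.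
have dmin0 : 0 < dmin by rewrite /dmin; elim/big_ind: _ => // x y x0 y0; rewrite lt_min x0.
have dminP x y : 0 < d x y -> dmin <= d x y.
  by move=> dxy; rewrite /dmin (bigD1 (x, y)) //= ge_min lexx.
(* Chosen so that [m * (rate 1 * Lc) = dmin], which puts every positive distance at or above the
   lowest threshold. *)
pose c : R := m%:R * m%:R * m.+1%:R * Lc%:R.
have c0 : 0 < c by rewrite !mulr_gt0 // ltr0n.
pose h s : R := dmin / c * m.+1%:R ^+ s.
have h0 : 0 < h 0%N by rewrite /h expr0 mulr1 divr_gt0.
have hS s : h s.+1 = m.+1%:R * h s by rewrite /h exprS mulrCA.
have hgrow s : s%:R * h 0%N <= h s.
  rewrite /h expr0 mulr1 mulrC ler_wpM2l ?(ltW (divr_gt0 dmin0 c0)) //.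
  by rewrite -natrX ler_nat ltnW // ltn_expl // ltnS.
have hunb x : exists s, x < h s.
  exists (Num.truncn (x / h 0%N)).+1; apply: lt_le_trans (hgrow _).
  by rewrite -ltr_pdivrMr // truncnS_gt.
pose rate s := m%:R * h s.
pose tmax := \sum_x wlength (W x).
have tmaxP x : wlength (W x) <= tmax.
  rewrite /tmax (bigD1 x) //= lerDl sumr_ge0 // => y _.
  by rewrite /wlength big_seq sumr_ge0 // => g /(allP (W0 y)).
have [S hSm] := hunb tmax.
have totS x : wlength (W x) <= rate S.+1.
  apply: le_trans (tmaxP x) _; apply: le_trans (ltW hSm) _.
  apply: le_trans (height_le h0 hS (leqnSn S)) _.
  by rewrite ler_peMl ?ler1n // ltW // (height_gt0 h0 hS).
pose Pm := (\max_(x : V) \max_(s < S) size (str m (h s.+1) (rate s.+2) 0 0 (W x))).+1.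
have fits x s : (s < S)%N -> (size (str m (h s.+1) (rate s.+2) 0 0 (W x)) < Pm)%N.
  move=> sS; rewrite ltnS; apply: leq_trans (leq_bigmax x).
  exact: (leq_bigmax (F := fun s : 'I_S =>
    size (str m (h s.+1) (rate s.+2) 0 0 (W x))) (Ordinal sS)).
have [lam code] := exists_tree_code rE Pm.
pose f x := @embed R m r S Pm (5 * m * m.+1 * Lc + 1) lam h (W x).
exists f => x y dxy.
suff main : forall x' y' p k (a b : R) (u v : word R) (D := b - a + wlength u + wlength v : R),
    W x' = rcons p (k, a) ++ u -> W y' = rcons p (k, b) ++ v -> diverging u v ->
    a <= b -> dmin <= D ->
    (1 - 74 / m%:R) * D
      <= \sum_c `|f x' c - f y' c| <= D.
  have dm := dminP _ _ dxy.
  have [p [k [a [b [u [v [Wx Wy uv dE]]]]]]] := Wd x y; rewrite dE in dm *.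
  have [ab|/ltW ba] := leP a b.
    have E : `|a - b| = b - a by rewrite distrC ger0_norm // subr_ge0.
    by rewrite E in dm *; exact: main Wx Wy uv ab dm.
  have E : `|a - b| = a - b by rewrite ger0_norm // subr_ge0.
  rewrite E addrAC in dm *; under eq_bigr => e _ do rewrite distrC.
  exact: main Wy Wx (diverging_sym uv) ba dm.
move=> x' y' p k a b u v D Wx Wy uv ab dD.
have a0 : 0 <= a by have := W0 x'; rewrite Wx /nneg all_cat all_rcons /= -andbA => /andP[].
have p0 : nneg p by have := W0 x'; rewrite Wx /nneg all_cat all_rcons /= -andbA => /and3P[].
have u0 : nneg u by have := W0 x'; rewrite Wx /nneg all_cat => /andP[].
have v0 : nneg v by have := W0 y'; rewrite Wy /nneg all_cat => /andP[].
(* The least [t] with [P t] gives [s0 = t - 2]: failure at [t - 1] is [low] and success at [t] is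
   [high]. *)
pose P t := D < m%:R * (rate t * Lc%:R).
have exP : exists t, P t.
  have [t ht] := hunb (D / (m%:R * m%:R * Lc%:R)); exists t.
  have -> : P t = (D < h t * (m%:R * m%:R * Lc%:R)) by rewrite /P /rate; congr (_ < _); ring.
  by rewrite -ltr_pdivrMr ?mulr_gt0.
case: (ex_minnP exP) => t Pt tmin.
have P1 s : (s <= 1)%N -> ~~ P s.
  move=> s1; rewrite /P -leNgt; apply: le_trans dD.
  have : rate s <= rate 1%N by rewrite ler_wpM2l // (height_le h0 hS).
  have c1 : 0 <= m%:R * Lc%:R :> R by rewrite ltW // mulr_gt0.
  move/(ler_wpM2l c1); rewrite -mulrA [Lc%:R * _]mulrC => /le_trans; apply.
  rewrite /rate /h expr1 le_eqVlt; apply/orP; left; apply/eqP.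
  by rewrite /c; field; rewrite !gt_eqF ?addr_gt0 ?ltr0n.
have t2 : (2 <= t)%N by rewrite ltnNge; apply/negP => /P1; rewrite Pt.
have tE : t = (t - 2).+2 by rewrite -[LHS](subnK t2) addn2.
have notP : ~~ P (t - 2).+1 by apply/negP => /tmin; rewrite {1}tE ltnn.
rewrite /f Wx Wy.
apply: (embed_dist (s0 := t - 2) m0 h0 hS code p0 u0 v0 a0 ab uv _ (Lc := Lc)) => //.
- by move=> s sS; rewrite -Wx -Wy !fits.
- by rewrite -Wx.
- by rewrite -Wy.
- by rewrite -Wx.
- by rewrite -Wy.
- by move: notP; rewrite /P -leNgt.
- by rewrite -tE ltW.
Qed.

Lemma incomparable_sym x y : incomparable x y -> incomparable y x.
Proof. by move=> [z [x' [y' [b [-> ->]]]]]; exists z, y', x', (~~ b); rewrite negbK. Qed.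

Lemma incomparable_size (x y : seq bool) : size x = size y -> x != y -> incomparable x y.
Proof.
elim: x y => [|b x IHx] [|c y] //= [sxy]; rewrite eqseq_cons negb_and.
have [<- /= /(IHx _ sxy)[z [x' [y' [d [-> ->]]]]]|bc _] := eqVneq b c.
  by exists (b :: z), x', y', d.
exists [::], x, y, b; split=> //=; congr (_ :: _).
by case: b c bc => [] [].
Qed.

Definition heads_differ (V : eqType) (s t : seq V) : bool :=
  if s is x :: _ then if t is y :: _ then x != y else true else true.

Lemma split_common (V : eqType) (s t : seq V) : exists q s' t',
  [/\ s = q ++ s', t = q ++ t' & heads_differ s' t'].
Proof.
elim: s t => [|x s IHs] [|y t]; [by exists [::], [::], [::] | by exists [::], [::], (y :: t) |
  by exists [::], (x :: s), [::] | ].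
have [<-|xy] := eqVneq x y; last by exists [::], (x :: s), (y :: t).
by have [q [s' [t' [-> -> h]]]] := IHs t; exists (x :: q), s', t'.
Qed.

Lemma mem_split (V : eqType) (x : V) s : x \in s -> exists p q, s = p ++ x :: q.
Proof. by case/path.splitPr => p q; exists p, q. Qed.

Lemma index_last_cat (V : eqType) (r y : V) s1 s2 : uniq (r :: s1 ++ y :: s2) ->
  nth r (s1 ++ y :: s2) (index (last r s1) (r :: s1 ++ y :: s2)) = y.
Proof.
rewrite -cat_cons => U.
have -> : index (last r s1) ((r :: s1) ++ y :: s2) = size s1.
  by rewrite index_cat mem_last index_last //; move: U; rewrite cat_uniq => /andP[].
by rewrite nth_cat ltnn subnn.
Qed.

Section TreeWords.
Variables (R : realType) (T : metric_tree R).
Local Notation V := (vertex T).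
Local Notation e := (@edge R T).
Variable r : V.
Implicit Types (x y z u v : V) (p q s : seq V).

Definition simple_to v p := [&& path e r p, last r p == v & uniq (r :: p)].

Lemma simple_to_ex v : exists p, simple_to v p.
Proof.
have [_ _ _ /(_ r v) /connectP[p ep ->] _] := edge_tree T.
by case: (shortenP ep) => q eq Uq _; exists q; rewrite /simple_to eq eqxx Uq.
Qed.

Definition sp v := xchoose (simple_to_ex v).

Lemma spP v : simple_to v (sp v). Proof. exact: xchooseP. Qed.

Lemma sp_path v : path e r (sp v). Proof. by case/and3P: (spP v). Qed.
Lemma sp_last v : last r (sp v) = v. Proof. by case/and3P: (spP v) => _ /eqP. Qed.
Lemma sp_uniq v : uniq (r :: sp v). Proof. by case/and3P: (spP v). Qed.

Lemma sp_eq v p : path e r p -> last r p = v -> uniq (r :: p) -> sp v = p.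
Proof.
move=> ep lp Up; apply: (simple_path_inj (sp_path v) ep (sp_uniq v) Up).
by rewrite sp_last.
Qed.

Lemma sp_prefix v p q : sp v = p ++ q -> sp (last r p) = p.
Proof.
move=> E; apply: sp_eq => //; have := sp_path v; have := sp_uniq v; rewrite E.
  by rewrite cat_path => _ /andP[].
by rewrite -cat_cons cat_uniq => /andP[].
Qed.

Lemma sp_prefix_rcons v p x q : sp v = p ++ x :: q -> sp x = rcons p x.
Proof. by rewrite -cat_rcons => /sp_prefix; rewrite last_rcons. Qed.

Lemma sp_root : sp r = [::]. Proof. exact: sp_eq. Qed.

(** * Subtree sizes, heavy children and light vertices *)

Definition desc x := #|[pred y | x \in r :: sp y]|.

Lemma desc_gt0 x : (0 < desc x)%N.
Proof.
apply/card_gt0P; exists x; rewrite inE.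
by have := mem_last r (sp x); rewrite sp_last.
Qed.

Lemma desc_root : desc r = #|V|.
Proof. by apply: eq_card => y; rewrite !inE eqxx. Qed.

Definition parent x := last r (take (size (sp x)).-1 (sp x)).

Lemma parentE v p x q : sp v = p ++ x :: q -> parent x = last r p.
Proof.
by move=> /sp_prefix_rcons E; rewrite /parent E size_rcons /= -cats1 take_size_cat.
Qed.

(** On a given root path the successor is a function of the parent, so the path contains at most one
    child of any vertex. *)
Lemma parent_next v x : x \in sp v ->
  x = nth r (sp v) (index (parent x) (r :: sp v)).
Proof.
case/mem_split=> p [q E].
have U := sp_uniq v; rewrite (parentE E) E in U *.
by rewrite index_last_cat.
Qed.

Lemma desc_parent x y : x \in r :: sp y -> (desc y <= desc x)%N.
Proof.
move=> xy; apply/subset_leq_card/subsetP => z; rewrite !inE.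
case/predU1P=> [yr|]; first by move: xy; rewrite yr sp_root !inE => ->.
case/mem_split=> p [q E].
have := sp_prefix_rcons E => Ey; move: xy; rewrite Ey E !inE mem_rcons mem_cat !inE.
by case/or3P=> ->; rewrite ?orbT.
Qed.

Definition child x y := (y != r) && (parent y == x).

(** A vertex without children gets the default [r], which is the child of no vertex. *)
Definition heavy x :=
  odflt r [pick y | child x y && [forall z, child x z ==> (desc z <= desc y)%N]].

Definition light x := (x != r) && (x != heavy (parent x)).

Lemma mem_sp_neq y : y != r -> y \in sp y.
Proof. by have := mem_last r (sp y); rewrite sp_last inE => /orP[->|]. Qed.

(** The subtrees of [y] and of its heavy sibling, which is at least as large, are disjoint and lie
    in that of the parent. *)
Lemma light_desc y : light y -> (2 * desc y <= desc (parent y))%N.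
Proof.
case/andP=> yr; rewrite /heavy; case: pickP => [c|none] /=; last first.
  have cy : child (parent y) y by rewrite /child yr eqxx.
  case: (arg_maxnP desc cy) => c cc cmax _; move: (none c); rewrite cc /=.
  by move/negbT; rewrite negb_forall => /existsP[z]; rewrite negb_imply => /andP[/cmax /= ->].
case/andP=> /andP[cr /eqP pc] /forallP cmax yc.
have le : (desc y <= desc c)%N by have := cmax y; rewrite /child yr eqxx.
apply: leq_trans (_ : desc y + desc c <= _)%N; first by rewrite mul2n -addnn leq_add2l.
rewrite -cardUI [X in (_ + X)%N](_ : _ = 0%N) ?addn0.
  apply/subset_leq_card/subsetP => z; rewrite !inE => yz.
  have par t : t != r -> parent t = parent y -> (t == r) || (t \in sp z) ->
      (parent y == r) || (parent y \in sp z).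
    move=> tr <-; rewrite (negPf tr) /= => tz.
    case/mem_split: tz => p [q E]; rewrite E (parentE E) mem_cat.
    by have := mem_last r p; rewrite inE => /orP[->|->]; rewrite ?orbT.
  by case/orP: yz; apply: par.
apply: eq_card0 => z; rewrite !inE (negPf yr) (negPf cr) /=; apply/negP => /andP[yz cz].
by move: yc; rewrite (parent_next yz) (parent_next cz) pc eqxx.
Qed.

Definition lights p := filter light p.

(* The top of the heavy path from which the heavy path of [b] branches off. *)
Definition pre b := last r (lights (take (size (sp b)).-1 (sp b))).

Lemma preE v p b q : sp v = p ++ b :: q -> pre b = last r (lights p).
Proof.
by move=> /sp_prefix_rcons E; rewrite /pre E size_rcons /= -cats1 take_size_cat.
Qed.

Lemma last_lights p : last r (lights p) \in r :: p.
Proof.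
by have := mem_last r (lights p); rewrite !inE mem_filter => /orP[->|/andP[_ ->]]; rewrite ?orbT.
Qed.

(** A root path meets at most one light vertex with a given [pre], so the subtrees of such vertices
    are disjoint. *)
Lemma pre_next v b : light b -> b \in sp v ->
  b = nth r (lights (sp v)) (index (pre b) (r :: lights (sp v))).
Proof.
move=> lb /mem_split[p [q E]].
have U : uniq (r :: lights (sp v)).
  have := sp_uniq v; rewrite /= mem_filter negb_and => /andP[-> U].
  by rewrite orbT filter_uniq.
have E' : lights (sp v) = lights p ++ b :: lights q by rewrite E /lights filter_cat /= lb.
by rewrite (preE E) E' index_last_cat // -E'.
Qed.

Lemma pre_desc b : light b -> (2 * desc b <= desc (pre b))%N.
Proof.
move=> lb; apply: leq_trans (light_desc lb) _.
have [p [q E]] := mem_split (mem_sp_neq (proj1 (andP lb))).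
apply: desc_parent; rewrite (parentE E) (sp_prefix E) (preE E); exact: last_lights.
Qed.

(** * Prefix-free names *)

Definition class b := trunc_log 2 (desc (pre b) %/ desc b).

Lemma class_bounds b : light b ->
  [/\ (0 < class b)%N, (2 ^ class b * desc b <= desc (pre b))%N &
      (desc (pre b) < 2 ^ (class b).+1 * desc b)%N].
Proof.
move=> lb; have b0 := desc_gt0 b.
have d2 : (2 <= desc (pre b) %/ desc b)%N by rewrite leq_divRL // pre_desc.
split.
- by rewrite trunc_log_gt0.
- by rewrite -leq_divRL // trunc_logP // (leq_trans _ d2).
- by rewrite -ltn_divLR // trunc_log_ltn.
Qed.

Definition siblings b := enum [pred c | [&& light c, pre c == pre b & class c == class b]].

Lemma pre_mem v b : b \in sp v -> pre b \in r :: sp v.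
Proof.
case/mem_split=> p [q E]; rewrite (preE E) E -cat_cons mem_cat.
by rewrite last_lights.
Qed.

(** Sibling subtrees are disjoint inside that of [pre b], and each has more than a
    [2 ^ (class b).+1]-th of its size. *)
Lemma size_siblings b : light b -> (size (siblings b) <= 2 ^ (class b).+1)%N.
Proof.
move=> lb; have g0 := desc_gt0 (pre b).
pose K := [pred c | [&& light c, pre c == pre b & class c == class b]].
rewrite -cardE -/K.
have le1 : (\sum_(c in K) desc c <= desc (pre b))%N.
  have descE x : desc x = (\sum_y (x \in r :: sp y))%N.
    by rewrite /desc -sum1_card big_mkcond; apply: eq_bigr => y _; rewrite !inE; case: (_ || _).
  rewrite (eq_bigr (fun c => \sum_y (c \in r :: sp y))%N) => [|c _]; last exact: descE.
  rewrite exchange_big /= descE; apply: leq_sum => y _.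
  have [c /andP[/and3P[lc /eqP pc cc] cy]|none] :=
    pickP [pred c | (c \in K) && (c \in r :: sp y)]; last first.
    rewrite big1 // => c cK; have := none c; rewrite /= cK /= => ->//.
  have lsp x : light x -> (x \in r :: sp y) = (x \in sp y).
    by case/andP=> xr _; rewrite inE (negPf xr).
  rewrite lsp // in cy.
  rewrite -pc (pre_mem cy) (bigD1 c) /=; last by rewrite inE lc pc cc eqxx.
  rewrite big1 ?addn0 ?leq_b1 // => x /andP[/and3P[lx /eqP px _] xc].
  apply/eqP; rewrite eqb0 lsp //; apply: contra xc => xy; apply/eqP.
  by rewrite (pre_next lx xy) (pre_next lc cy) px pc.
rewrite -(leq_pmul2r g0); apply: leq_trans (leq_mul (leqnn (2 ^ (class b).+1)%N) le1).
rewrite big_distrr /= -sum_nat_const; apply: leq_sum => c /and3P[lc /eqP <- /eqP <-].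
by have [_ _ /ltnW] := class_bounds lc.
Qed.

Definition bits k i : seq bool := tval (nth [tuple of nseq k false] (enum {: k.-tuple bool}) i).

Lemma size_bits k i : size (bits k i) = k.
Proof. exact: size_tuple. Qed.

Lemma bits_inj k i j : (i < 2 ^ k)%N -> (j < 2 ^ k)%N -> bits k i = bits k j -> i = j.
Proof.
move=> ik jk /val_inj/eqP; rewrite nth_uniq ?enum_uniq -?cardE ?card_tuple ?card_bool //.
by move/eqP.
Qed.

(** A self-delimiting name: the class in unary, then the index among the siblings on [(class b).+1]
    bits. The heavy path of the root has the empty name. *)
Definition code b : seq bool :=
  if light b then
    nseq (class b) true ++ false :: bits (class b).+1 (index b (siblings b))
  else [::].

Lemma size_code b : (size (code b) <= 2 * class b + 2)%N.
Proof.
rewrite /code; case: ifP => // _; rewrite size_cat size_nseq /= size_bits; lia.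
Qed.

(** Different classes split where the shorter unary part ends; equal classes give equal lengths and
    different indices. *)
Lemma code_incomparable b c : light b -> light c -> b != c -> pre b = pre c ->
  incomparable (code b) (code c).
Proof.
move=> lb lc bc pbc.
wlog le : b c lb lc bc pbc / (class b <= class c)%N => [W|].
  have [le|/ltnW le] := leqP (class b) (class c); first exact: W.
  by apply: incomparable_sym; apply: W; rewrite // eq_sym.
rewrite /code lb lc; move: le; rewrite leq_eqVlt => /predU1P[E|lt].
  apply: incomparable_size; first by rewrite E !size_cat !size_nseq /= !size_bits.
  have sE : siblings b = siblings c by rewrite /siblings pbc E.
  rewrite E eqseq_cat // eqxx /= eqseq_cons eqxx /=; apply: contra bc => /eqP.
  have mem x : light x -> x \in siblings x by move=> lx; rewrite mem_enum inE lx !eqxx.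
  have bs : b \in siblings c by rewrite -sE mem.
  have cs : c \in siblings c by rewrite mem.
  have ix x : x \in siblings c -> (index x (siblings c) < 2 ^ (class c).+1)%N.
    by move=> xs; rewrite (leq_trans _ (size_siblings lc)) // index_mem.
  rewrite sE => /(bits_inj (ix _ bs) (ix _ cs)) EE; apply/eqP.
  by rewrite -(nth_index r bs) EE nth_index.
exists (nseq (class b) true), (bits (class b).+1 (index b (siblings b))),
  (nseq (class c - (class b).+1) true ++ false :: bits (class c).+1 (index c (siblings c))), false.
split=> //; rewrite -[true :: _]/(nseq (class c - (class b).+1).+1 true ++ _).
by rewrite catA -nseqD subnSK // subnKC // ltnW.
Qed.

(** Each light vertex divides the subtree size by at least [2 ^ class], and these drops multiply
    along the root path. *)
Lemma class_sum v :
  (2 ^ (\sum_(b <- lights (sp v)) class b) * desc (last r (lights (sp v))) <= #|V|)%N.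
Proof.
move E : (sp v) => p; elim/last_ind: p v E => [|p x IHp] v E.
  by rewrite big_nil expn0 mul1n /= desc_root.
have Ep : sp (last r p) = p by apply: (sp_prefix (v := v) (q := [:: x])); rewrite E cats1.
have := IHp _ Ep; rewrite /lights filter_rcons; case: ifP => // lx.
rewrite big_rcons /= last_rcons; apply: leq_trans.
have [_ + _] := class_bounds lx; rewrite (preE (v := v) (p := p) (q := [::])) ?E ?cats1 //.
rewrite expnD -mulnA leq_mul2l => ->; exact: orbT.
Qed.

(** * Words of vertices and their metric *)

Local Notation wl := (@walk_length R T).
Local Notation elen x y := (len (m := T) [set x; y]%SET).

(* The heavy paths met by the walk [p] from [x], when [l] has already been
   travelled on the heavy path with top [b]; the top of a heavy path stands for
   the path. *)
Fixpoint segments b (l : R) x p : seq (V * R) :=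
  if p is y :: p' then
    if light y then (b, l) :: segments y (elen x y) y p'
    else segments b (l + elen x y) y p'
  else [:: (b, l)].

Lemma wl_cons x y p : wl x (y :: p) = elen x y + wl y p.
Proof. by rewrite /walk_length /= big_cons. Qed.

Lemma wl_nil x : wl x [::] = 0.
Proof. by rewrite /walk_length big_nil. Qed.

Lemma sum_segments b l x p : \sum_(g <- segments b l x p) g.2 = l + wl x p.
Proof.
elim: p b l x => [|y p IHp] b l x /=; first by rewrite big_seq1 wl_nil addr0.
by rewrite wl_cons; case: ifP => _; rewrite ?big_cons IHp //= addrA.
Qed.

Lemma segments_tops b l x p : map fst (segments b l x p) = b :: lights p.
Proof. by elim: p b l x => [//|y p IHp] b l x /=; case: ifP => _ /=; rewrite IHp. Qed.

Lemma segments_ge0 b l x p : 0 <= l -> path e x p -> all (fun g => 0 <= g.2) (segments b l x p).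
Proof.
elim: p b l x => [|y p IHp] b l x l0 /=; first by rewrite l0.
case/andP=> exy ep; have len0 := len_ge0 exy.
by case: ifP => _ /=; rewrite ?l0 IHp // addr_ge0.
Qed.

Lemma segments_cat b l x p : exists P b' l', forall q,
  segments b l x (p ++ q) = P ++ segments b' l' (last x p) q.
Proof.
elim: p b l x => [|y p IHp] b l x /=; first by exists [::], b, l.
case: (light y).
  by have [P [b' [l' E]]] := IHp y (elen x y) y; exists ((b, l) :: P), b', l' => q; rewrite E.
exact: IHp.
Qed.

Lemma segments_head b l x p : path e x p -> exists l' w,
  [/\ segments b l x p = (b, l') :: w, l <= l',
      (if p is y :: _ then light y else true) -> l' = l &
      forall c, ohead (map fst w) = Some c ->
        exists p1 p2, [/\ p = p1 ++ c :: p2, light c & lights p1 = [::]]].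
Proof.
elim: p b l x => [|y p IHp] b l x /=; first by exists l, [::]; split.
case/andP=> exy ep; case: ifPn => ly.
  exists l, (segments y (elen x y) y p); split=> // c; rewrite segments_tops /= => -[<-].
  by exists [::], p.
have [l' [w [E ll _ hw]]] := IHp b (l + elen x y) y ep.
exists l', w; split=> //; first by rewrite (le_trans _ ll) // lerDl len_ge0.
move=> c /hw[p1 [p2 [-> lc l1]]]; exists (y :: p1), p2; split=> //=.
by rewrite (negPf ly).
Qed.

Definition to_word (w : seq (V * R)) : word R := map (fun g => (code g.1, g.2)) w.

Definition tree_word v : word R := to_word (segments r 0 r (sp v)).

Lemma tree_word_nneg v : nneg (tree_word v).
Proof. by rewrite /nneg /tree_word /to_word all_map; apply: segments_ge0 (sp_path v). Qed.

Lemma tree_word_cost v : (cost (tree_word v) <= 1 + 5 * trunc_log 2 #|V|)%N.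
Proof.
rewrite /cost /tree_word /to_word big_map.
have -> : (\sum_(g <- segments r 0%R r (sp v)) (size (code g.1)).+1
   = \sum_(b <- map fst (segments r 0%R r (sp v))) (size (code b)).+1)%N by rewrite big_map.
rewrite segments_tops big_cons {1}/code /light eqxx /= leq_add2l.
(* A light vertex costs at most [2 * class + 3] bits, and its class is at least 1. *)
apply: leq_trans (_ : \sum_(b <- lights (sp v)) 5 * class b <= _)%N.
  rewrite big_seq [X in (_ <= X)%N]big_seq; apply: leq_sum => b.
  rewrite mem_filter => /andP[lb _]; have [c1 _ _] := class_bounds lb.
  by have := size_code b; lia.
rewrite -big_distrr leq_mul2l /=; apply: trunc_log_max => //.
by apply: leq_trans (class_sum v); rewrite leq_pmulr // desc_gt0.
Qed.

Lemma wlength_to_word w : wlength (to_word w) = \sum_(g <- w) g.2.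
Proof. by rewrite /wlength big_map. Qed.

(** A common vertex would have a single simple path from the root, so the two tails would begin
    alike. *)
Lemma sp_disjoint u v q pu pv : sp u = q ++ pu -> sp v = q ++ pv ->
  heads_differ pu pv ->
  ~~ has (mem pu) pv.
Proof.
move=> Eu Ev hd; apply/hasPn => z /mem_split[v1 [v2 Ev1]].
apply/negP => /mem_split[u1 [u2 Eu1]].
have : rcons (q ++ u1) z = rcons (q ++ v1) z.
  rewrite -(@sp_prefix_rcons u (q ++ u1) z u2) ?Eu ?Eu1 -?catA //.
  by rewrite -(@sp_prefix_rcons v (q ++ v1) z v2) ?Ev ?Ev1 -?catA.
rewrite !rcons_cat => /eqP; rewrite eqseq_cat // eqxx /= => /eqP E.
move: hd; rewrite Eu1 Ev1; case: u1 v1 {Eu1 Ev1} E => [|x u1] [|y v1] //=.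
- by rewrite eqxx.
- by case=> _ /esym/eqP; rewrite -cats1; case: v1.
- by case=> _ /eqP; rewrite -cats1; case: u1.
- by case=> -> _; rewrite eqxx.
Qed.

(** Reversing one tail and appending the other gives a simple walk, and simple walks realise the
    distance. *)
Lemma tree_dist_split u v q pu pv : sp u = q ++ pu -> sp v = q ++ pv ->
  heads_differ pu pv ->
  tree_dist u v = wl (last r q) pu + wl (last r q) pv.
Proof.
move=> Eu Ev hd; set w := last r q.
have [eu ev] : path e w pu /\ path e w pv.
  by have := sp_path u; have := sp_path v; rewrite Eu Ev !cat_path => /andP[_ ->] /andP[_ ->].
have lu : last w pu = u by rewrite -(sp_last u) Eu last_cat.
have lv : last w pv = v by rewrite -(sp_last v) Ev last_cat.
have lr : last u (rev (belast w pu)) = w.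
  by rewrite -lu; case: (pu) => [//|x p]; rewrite /= rev_cons last_rcons.
have -> : v = last u (rev (belast w pu) ++ pv) by rewrite last_cat lr.
rewrite tree_distE; first by rewrite walk_length_cat lr -lu walk_length_rev.
  rewrite cat_path lr ev andbT -lu rev_path.
  by rewrite (eq_path (e' := e)) // => x y; rewrite edgeC.
rewrite -cat_cons.
have -> : u :: rev (belast w pu) = rev (w :: pu).
  by rewrite -{1}lu (lastI w pu) rev_rcons.
have Uu := sp_uniq u; have Uv := sp_uniq v; rewrite Eu Ev in Uu Uv.
have wE p : r :: q ++ p = belast r q ++ (w :: p) by rewrite -cat_cons lastI cat_rcons.
rewrite !wE !cat_uniq in Uu Uv; case/and3P: Uu => _ _ Uu; case/and3P: Uv => _ _ Uv.
rewrite cat_uniq rev_uniq Uu /= andbC; move: Uv => /= /andP[wv ->] /=.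
apply/hasPn => z zv; rewrite /= mem_rev inE negb_or.
have /hasPn/(_ z zv) /= -> := sp_disjoint Eu Ev hd; rewrite andbT.
by apply: contra wv => /eqP <-.
Qed.

Lemma tree_word_metric u v : word_metric (tree_dist u v) (tree_word u) (tree_word v).
Proof.
have [q [pu [pv [Eu Ev hd]]]] := split_common (sp u) (sp v).
rewrite (tree_dist_split Eu Ev hd) /tree_word Eu Ev; set w := last r q.
have [P [b [l E]]] := segments_cat r 0 r q.
have [eu ev] : path e w pu /\ path e w pv.
  by have := sp_path u; have := sp_path v; rewrite Eu Ev !cat_path => /andP[_ ->] /andP[_ ->].
rewrite !E -/w.
have [a [u' [Su la au hu]]] := segments_head b l eu.
have [a' [v' [Sv la' av hv]]] := segments_head b l ev.
have := sum_segments b l w pu; have := sum_segments b l w pv.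
rewrite Su Sv !big_cons /= => totv totu.
exists (to_word P), (code b), a, a', (to_word u'), (to_word v'); split.
- by rewrite /to_word map_cat cat_rcons.
- by rewrite /to_word map_cat cat_rcons.
- case: u' hu {Su totu} => [|[c lc] u'] hu //; case: v' hv {Sv totv} => [|[c' lc'] v'] hv //=.
  have [p1 [p2 [Epu lic l1]]] := hu c erefl.
  have [p1' [p2' [Epv lic' l1']]] := hv c' erefl.
  apply: code_incomparable => //.
    apply/eqP => cc'; have /hasP[] := sp_disjoint Eu Ev hd; exists c'.
      by rewrite Epv mem_cat mem_head orbT.
    by rewrite /= Epu cc' mem_cat mem_head orbT.
  rewrite (preE (v := u) (p := q ++ p1) (q := p2)) ?Eu ?Epu -?catA //.
  rewrite (preE (v := v) (p := q ++ p1') (q := p2')) ?Ev ?Epv -?catA //.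
  by rewrite /lights !filter_cat -!/(lights _) l1 l1'.
rewrite !wlength_to_word.
(* At most one branch can continue along the heavy path, so one of the two words ends its segment at
   [l] and [|a - a'|] is the length that the other adds to it. *)
suff [E1|E1] : a = l \/ a' = l.
- by rewrite E1 distrC ger0_norm ?subr_ge0 //; move: totu totv; rewrite E1; lra.
- by rewrite E1 ger0_norm ?subr_ge0 //; move: totu totv; rewrite E1; lra.
case: pu Eu au hd {eu hu Su totu} => [|x pu] Eu au hd; first by left; exact: au.
case: pv Ev av hd {ev hv Sv totv} => [|y pv] Ev av hd; first by right; exact: av.
have [lx|nlx] := boolP (light x); first by left; exact: au.
have [ly|nly] := boolP (light y); first by right; exact: av.
have root z p t : sp t = q ++ z :: p -> z != r.
  by move=> Et; have := sp_uniq t; rewrite Et /= mem_cat inE !negb_or eq_sym => /andP[/and3P[]].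
move: nlx nly; rewrite /light (root _ _ _ Eu) (root _ _ _ Ev) /= !negbK.
by rewrite (parentE Eu) (parentE Ev) => /eqP xh /eqP yh; move: hd; rewrite /= xh yh eqxx.
Qed.

End TreeWords.

(** * The embedding of tree metrics *)

From mathcomp Require Import all_classical all_reals all_analysis.

Lemma distortion_le (R : realType) (X Y : Type) (dX : X -> X -> R) (dY : Y -> Y -> R)
    (f : X -> Y) (c : R) : 0 < c -> (forall x, dY (f x) (f x) = 0) ->
  (forall x y, x <> y -> 0 < dX x y /\ c * dX x y <= dY (f x) (f y) <= dX x y) ->
  (distortion dX dY f <= (c^-1)%:E)%E.
Proof.
move=> c0 f0 H.
have inj : injective f.
  move=> x y fxy; apply: contrapT => xy; have [d0 /andP[+ _]] := H _ _ xy.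
  by rewrite fxy f0 pmulr_rle0 // leNgt d0.
rewrite /distortion asboolT //.
have l0 : (0 <= lip_norm dX dY f)%E by apply: ereal_sup_ubound; left.
have l1 : (lip_norm dX dY f <= 1%:E)%E.
  apply: ge_ereal_sup => _ [->|[x [y [xy ->]]]]; first by rewrite lee_fin.
  by have [d0 /andP[_ le]] := H _ _ xy; rewrite lee_fin ler_pdivrMr // mul1r.
have l2 : (lip_norm_inv dX dY f <= (c^-1)%:E)%E.
  apply: ge_ereal_sup => _ [->|[x [y [fxy ->]]]]; first by rewrite lee_fin invr_ge0 ltW.
  have xy : x <> y by move=> xy; apply: fxy; rewrite xy.
  have [d0 /andP[le _]] := H _ _ xy.
  have dy0 : 0 < dY (f x) (f y) by rewrite (lt_le_trans _ le) // mulr_gt0.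
  by rewrite lee_fin ler_pdivrMr // mulrC ler_pdivlMr // mulrC.
have l3 : (0 <= lip_norm_inv dX dY f)%E by apply: ereal_sup_ubound; left.
rewrite -[leRHS]mul1e; exact: lee_pmul.
Qed.

Lemma points_dist_gt0 (R : realType) (T : metric_tree R) (x y : tree_points T) :
  x <> y -> 0 < points_dist x y.
Proof.
move=> xy; rewrite lt_def tree_dist_ge0 andbT; apply/negP => d0; apply: xy.
by rewrite -[x]reprK -[y]reprK; apply/eqquotP.
Qed.

Theorem theorem1p1 (R : realType) :
  exists C : R, 0 < C /\
    forall eps : R, 0 < eps <= 1 / 2 ->
    forall (n : nat) (T : metric_tree R), #|vertex T| = n ->
    exists (k : nat) (f : tree_points T -> 'rV[R]_k),
      (distortion points_dist l1_dist f <= (1 + eps)%:E)%E /\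
      k%:R <= C * (1 / eps) ^+ 4 * ln (1 / eps) * ln n%:R.
Proof.
have ln2 : 0 < ln 2 :> R by rewrite ln_gt0 // ltr1n.
(* Here 288 comes from counting coordinates and [149 ^+ 4] from [m]; the two factors [ln 2] come
   from comparing [trunc_log 2 n] with [ln n] and from bounding [ln (1 / eps)] below. *)
exists (288 * 149 ^+ 4 / ln 2 ^+ 2); split; first by rewrite !mulr_gt0 ?invr_gt0 ?exprn_gt0.
move=> eps /andP[eps0 eps2] n T nE.
have l10 k (a : 'rV[R]_k) : l1_dist a a = 0.
  by rewrite /l1_dist big1 // => i _; rewrite subrr normr0.
have e1 : 0 < (1 + eps)^-1 by rewrite invr_gt0; lra.
(* A single point has to go into dimension 0, as [ln n] vanishes. *)
have [n1|n2] := leqP n 1.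
  exists 0%N, (fun=> 0); split.
    rewrite -[1 + eps]invrK; apply: distortion_le => // x y xy.
    have /fintype_le1P all1 : (#|vertex T| <= 1)%N by rewrite nE.
    by case: xy; rewrite -[x]reprK -[y]reprK (all1 (repr x) (repr y)).
  have -> : ln n%:R = 0 :> R.
    by move: n1; rewrite leq_eqVlt ltnS leqn0 => /orP[]/eqP ->; rewrite ?ln1 ?ln0.
  by rewrite mulr0.
have [r _] : exists r, r \in vertex T by apply/card_gt0P; rewrite nE ltnW.
pose t := trunc_log 2 n; pose Lc := (1 + 5 * t)%N.
(* This gives [74 / m <= eps / 2], and [(1 - eps / 2) * (1 + eps) >= 1] yields the distortion. *)
pose m := (Num.truncn (148 / eps)).+1.
have m0 : (0 < m)%N by [].
have m148 : 148 / eps < m%:R by exact: truncnS_gt.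
have m149 : m%:R <= 149 / eps.
  have le : (Num.truncn (148 / eps))%:R <= 148 / eps by rewrite truncn_le divr_ge0 // ltW.
  have : 1 <= eps^-1 by rewrite -div1r ler_pdivlMr //; lra.
  have -> : m%:R = (Num.truncn (148 / eps))%:R + 1 :> R by rewrite natr1.
  by move: le; lra.
have L0 : (0 < Lc)%N by [].
have cost_le v : (cost (tree_word r v) <= Lc)%N by rewrite /Lc /t -nE; exact: tree_word_cost.
have [F HF] := word_embedding m0 L0 (tree_word_nneg r) cost_le (tree_word_metric r).
pose I := ('I_(5 * m * m.+1 * Lc + 1).+1 * 'I_m * 'I_(4 * m))%type.
pose g (x : tree_points T) := F (repr (x : {eq_quot _}%qT)).
pose f x : 'rV[R]_#|{: I}| := \row_i g x (enum_val i).
have fE x y : l1_dist (f x) (f y) = \sum_c `|g x c - g y c|.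
  rewrite /l1_dist (reindex (@enum_val I predT)) /=; last exact/onW_bij/enum_val_bij.
  by apply: eq_bigr => i _; rewrite !mxE.
exists #|{: I}|, f; split.
  rewrite -[1 + eps]invrK; apply: distortion_le => // x y /points_dist_gt0 d0; split=> //.
  have /andP[lo hi] := HF _ _ d0; rewrite fE hi andbT; apply: le_trans lo.
  rewrite ler_wpM2r ?(ltW d0) // -div1r ler_pdivrMr; last by lra.
  have : 74 / m%:R <= eps / 2.
    rewrite ler_pdivrMr ?ltr0n //; move: m148; rewrite ltr_pdivrMr //; lra.
  by move: eps0 eps2; nra.
have t0 : (0 < t)%N by rewrite /t trunc_log_gt0.
(* 288 is [12 * 4 * 6]: 12 bounds the number of residues, 4 is from the alphabet of size [4 * m],
   and 6 is from [Lc <= 6 * t]. *)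
have cardI : (#|{: I}| <= 288 * (m ^ 4 * t))%N.
  rewrite !card_prod !card_ord.
  have le1 : ((5 * m * m.+1 * Lc + 1).+1 <= 12 * (m ^ 2 * Lc))%N by nia.
  have le2 : (Lc <= 6 * t)%N by rewrite /Lc; lia.
  apply: leq_trans (leq_mul (leq_mul le1 (leqnn m)) (leqnn (4 * m)%N)) _.
  have -> : (12 * (m ^ 2 * Lc) * m * (4 * m) = 48 * m ^ 4 * Lc)%N by ring.
  have -> : (288 * (m ^ 4 * t) = 48 * m ^ 4 * (6 * t))%N by ring.
  by rewrite leq_mul2l le2 orbT.
have lnn : t%:R * ln 2 <= ln n%:R :> R.
  rewrite mulr_natl -lnXn // ler_ln ?posrE ?exprn_gt0 ?ltr0n //; last exact: ltnW.
  by rewrite -natrX ler_nat trunc_logP // ltnW.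
have lne : ln 2 <= ln (1 / eps).
  by rewrite ler_ln ?posrE ?divr_gt0 // ler_pdivlMr //; lra.
apply: le_trans (_ : 288 * ((149 / eps) ^+ 4 * t%:R) <= _).
  apply: le_trans (_ : 288 * (m%:R ^+ 4 * t%:R) <= _).
    by rewrite -natrX -!natrM ler_nat.
  rewrite ler_wpM2l // ler_wpM2r // lerXn2r ?nnegrE ?divr_ge0 // ltW //.
have -> : 288 * ((149 / eps) ^+ 4 * t%:R)
  = 288 * 149 ^+ 4 / ln 2 ^+ 2 * (1 / eps) ^+ 4 * ln 2 * (t%:R * ln 2) :> R.
  by field; rewrite !gt_eqF.
have c0 : 0 <= 288 * 149 ^+ 4 / ln 2 ^+ 2 * (1 / eps) ^+ 4 :> R.
  by rewrite !mulr_ge0 ?invr_ge0 ?exprn_ge0 ?divr_ge0 // ltW.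
apply: ler_pM => //; first by rewrite mulr_ge0 // ltW.
  by rewrite mulr_ge0 // ltW.
by rewrite ler_wpM2l.
Qed.
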